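(* Let $J,I\subseteq\mathbb{R}$ be open intervals containing $0$ and let $\gamma\colon J\times I\to\mathrm{AdS}$ be a solution of the LIEN flow $$\partial_t\gamma=2\partial_s^3\gamma-6\kappa\,\partial_s\gamma$$ with bending $\kappa(s,t)$, and denote by $(F_+,F_-)$ the spinor frame field along $\gamma(s,t)$. Given a real constant $\xi\neq0$ and a solution $f\colon J\times I\to\mathbb{R}$ of the Wahlquist--Estabrook equation $$df=\bigl(\kappa-f^2+\lambda\bigr)ds+\bigl(4\lambda[f^2-\lambda]-2\kappa[f^2+\lambda]+2\kappa^2+2f\,\partial_s\kappa-\partial_s^2\kappa\bigr)dt$$ for $\lambda=\cosh(2\xi)$, define the map $\widetilde\gamma\colon J\times I\to\mathrm{AdS}$ by $$\widetilde{\gamma}=\pm F_+\begin{pmatrix}\tanh(\xi)&-\operatorname{csch}(\xi)\operatorname{sech}(\xi)\,f\\0&\coth(\xi)\end{pmatrix}F_-^{-1}.$$ Then: 1. For every $t\in I$, the null curve $\widetilde\gamma_t=\widetilde\gamma(\cdot,t)$ is a $\mathcal{T}$-transform of $\gamma_t=\gamma(\cdot,t)$ with parameter $\xi$ and transforming function $f_t=f(\cdot,t)$. 2. The map $\widetilde\gamma\colon J\times I\to\mathrm{AdS}$ is a solution of the LIEN flow (that is, $\partial_t\widetilde\gamma=2\partial_s^3\widetilde\gamma-6\widetilde\kappa\,\partial_s\widetilde\gamma$, where $\widetilde\kappa(s,t)$ is the bending of $\widetilde\gamma$), and its bending $\widetilde\kappa$ is the Bäcklund transform of $\kappa$ with spectral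 parameter $\lambda$ and transforming function $f$, i.e. $\widetilde\kappa=-\kappa+2f^2-2\lambda$.
   Context: Anti-de Sitter space. On the space $\mathbb{R}^{2,2}$ of real $2\times2$ matrices let $\langle\cdot,\cdot\rangle$ be the inner product of the quadratic form $X\mapsto-\det X$. $\mathrm{AdS}$ denotes $\mathrm{SL}(2,\mathbb{R})\subset\mathbb{R}^{2,2}$ with the induced Lorentzian metric. On $\Lambda^2(\mathbb{R}^{2,2})$ set $\langle\langle U\wedge V,W\wedge Z\rangle\rangle=\langle U,W\rangle\langle V,Z\rangle-\langle U,Z\rangle\langle V,W\rangle$. A null tangent vector $T\in T_X\mathrm{AdS}$ is future-directed if $\langle\langle I_2\wedge \mathsf{J},X\wedge T\rangle\rangle>0$, where $I_2$ is the identity matrix and $\mathsf{J}=\begin{pmatrix}0&1\\-1&0\end{pmatrix}$. Null curves. ''Null curve'' means a smooth immersed curve $\gamma\colon J\to\mathrm{AdS}$ ($J$ an open interval, prime $=d/ds$) with $\langle\gamma',\gamma'\rangle=0$, future-directed velocity, no inflection points ($\gamma'\wedge\gamma''\neq0$ everywhere), parameterized by proper time ($\langle\gamma'',\gamma''\rangle=4$). Its bending is $\kappa=-\frac1{16}\langle\gamma''',\gamma'''\rangle$. Spinor frame field. The spinor frame field along a null curve $\gamma$ with bending $\kappa$ is the smooth map $(F_+,F_-)\colon J\to\mathrm{SL}(2,\mathbb{R})\times\mathrm{SL}(2,\mathbb{R})$, defined up to a (common) sign, such that $\gamma=F_+F_-^{-1}$ and $$F_+'=F_+\begin{pmatrix}0&\kappa+1\\1&0\end{pmatrix},\qquad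 F_-'=F_-\begin{pmatrix}0&\kappa-1\\1&0\end{pmatrix}.$$ All null curves are understood to come with such a spinor frame field. The pair of cousins $(\eta_+,\eta_-)$ associated with $\gamma$ consists of the first column vectors of $F_+$ and $F_-$; these are curves in $\mathbb{R}^2\setminus\{(0,0)\}$ with $\det(\eta_\pm,\eta_\pm')=1$. $\mathcal{T}$-transforms. Two null curves $\gamma,\widetilde\gamma\colon J\to\mathrm{AdS}$ with pairs of cousins $(\eta_+,\eta_-)$, $(\widetilde\eta_+,\widetilde\eta_-)$ are $\mathcal{T}$-transforms of each other if $\det(\eta_+,\widetilde\eta_+)$ and $\det(\eta_-,\widetilde\eta_-)$ are nonzero constants. The $\mathcal{T}$-transform is ''for $\chi=0$'' if moreover $\det(\eta_+,\widetilde{\eta}_+)\det(\eta_-,\widetilde{\eta}_-')-\det(\eta_-,\widetilde{\eta}_-)\det(\eta_+,\widetilde{\eta}_+')=0$. ''The $\mathcal{T}$-transform (for $\chi=0$) of $\gamma$ with parameter $\xi$ and transforming function $f$'', where $\xi\neq0$ is a constant and $f\colon J\to\mathbb{R}$ solves $f'+f^2=\kappa+\cosh(2\xi)$, is the $\mathcal{T}$-transform for $\chi=0$ given by $\pm F_+\begin{pmatrix}\tanh(\xi)&-\operatorname{csch}(\xi)\operatorname{sech}(\xi)f\\0&\coth(\xi)\end{pmatrix}F_-^{-1}$. LIEN flow. A solution of the LIEN flow is a smooth map $\gamma\colon J\times I\to\mathrm{AdS}$, $(s,t)\mapsto\gamma(s,t)=\gamma_t(s)$, such that for each $t\in I$ the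 curve $\gamma_t$ is a null curve (that is, a smooth immersed curve with $\langle\partial_s\gamma,\partial_s\gamma\rangle=0$, future-directed velocity $\partial_s\gamma$, no inflection points, i.e. $\partial_s\gamma\wedge\partial_s^2\gamma\neq0$ everywhere, and $\langle\partial_s^2\gamma,\partial_s^2\gamma\rangle=4$, so that $s$ is proper time), with $\partial_t\gamma=2\partial_s^3\gamma-6\kappa\,\partial_s\gamma$, where $\kappa(s,t)$ is the bending of $\gamma_t$ at $s$. The spinor frame field along $\gamma(s,t)$ is the smooth map $(F_+,F_-)\colon J\times I\to\mathrm{SL}(2,\mathbb{R})\times\mathrm{SL}(2,\mathbb{R})$ whose restriction to each fixed $t$ is the spinor frame field along $\gamma_t$. The bending of a solution of the LIEN flow satisfies the KdV equation $\partial_t\kappa+\partial_s^3\kappa-6\kappa\,\partial_s\kappa=0$. Bäcklund transform. For a solution $\kappa$ of this KdV equation, the Bäcklund transform of $\kappa$ with spectral parameter $\lambda\in\mathbb{R}\setminus\{0\}$ and transforming function $f\colon J\times I\to\mathbb{R}$ is the function $-\kappa+2f^2-2\lambda$. *)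

(* Defs.v *)
From HB Require Import structures.
From mathcomp Require Import all_boot all_order all_algebra.
From mathcomp Require Import all_classical all_reals all_analysis.

Set Implicit Arguments.
Unset Strict Implicit.
Unset Printing Implicit Defensive.

Import Order.TTheory GRing.Theory Num.Theory.
Import numFieldNormedType.Exports.

Local Open Scope ring_scope.
Local Open Scope classical_set_scope.

(* Curves on J and maps on J x I are total functions [R -> V], [R -> R -> V];
   conditions are imposed only at points of J, resp. of J x I. As J and I are
   open, derivatives there do not depend on the values outside. *)

Section Hyperbolic.
Context {R : realType}.
Implicit Type x : R.

Definition cosh x : R := (expR x + expR (- x)) / 2.
Definition sinh x : R := (expR x - expR (- x)) / 2.
Definition tanh x : R := sinh x / cosh x.
Definition coth x : R := cosh x / sinh x.
Definition sech x : R := (cosh x)^-1.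
Definition csch x : R := (sinh x)^-1.

End Hyperbolic.

Section Smoothness.
Context {R : realType} {V : normedModType R}.

Definition open_interval (J : set R) : Prop := open J /\ is_interval J.

Definition smooth1 (J : set R) (g : R -> V) : Prop :=
  forall (n : nat) (s : R), J s -> derivable (derive1n n g) s 1.

Definition partial_s (g : R -> R -> V) : R -> R -> V :=
  fun s t => derive1 (g^~ t) s.
Definition partial_t (g : R -> R -> V) : R -> R -> V :=
  fun s t => derive1 (g s) t.

Fixpoint Ck2 (k : nat) (J I : set R) (g : R -> R -> V) : Prop :=
  (forall s t, J s -> I t ->
     {for (s, t), continuous (fun p : R * R => g p.1 p.2)}) /\
  if k is k'.+1 then
    [/\ forall s t, J s -> I t -> derivable (g^~ t) s 1,
        forall s t, J s -> I t -> derivable (g s) t 1,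
        Ck2 k' J I (partial_s g)
      & Ck2 k' J I (partial_t g)]
  else True.

Definition smooth2 (J I : set R) (g : R -> R -> V) : Prop :=
  forall k : nat, Ck2 k J I g.

End Smoothness.

Section AntiDeSitter.
Context {R : realType}.
Implicit Types (X Y U V W Z T : 'M[R]_2) (J I : set R).

Definition mx22 (a b c d : R) : 'M[R]_2 :=
  \matrix_(i, j) (if i == 0 then if j == 0 then a else b
                  else if j == 0 then c else d).

(* Polarization of the quadratic form X |-> - \det X. *)
Definition ip X Y : R := - (\det (X + Y) - \det X - \det Y) / 2.

Definition AdS X : Prop := \det X = 1.

(* U /\ V in the exterior square of R^{2,2} = R^4, realized as the
   antisymmetric 4 x 4 matrix U (x) V - V (x) U. *)
Definition wedge U V : 'M[R]_(2 * 2) :=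
  (mxvec U)^T *m mxvec V - (mxvec V)^T *m mxvec U.

(* << U /\ V, W /\ Z >> *)
Definition wedge_ip U V W Z : R := ip U W * ip V Z - ip U Z * ip V W.

Definition Jmx : 'M[R]_2 := mx22 0 1 (-1) 0.

Definition future_directed X T : Prop := 0 < wedge_ip 1%:M Jmx X T.

Definition bending (g : R -> 'M[R]_2) (s : R) : R :=
  - (ip (derive1n 3 g s) (derive1n 3 g s)) / 16.

Record null_curve J (g : R -> 'M[R]_2) : Prop := NullCurve {
  null_smooth : smooth1 J g;
  null_AdS : forall s, J s -> AdS (g s);
  null_immersed : forall s, J s -> derive1 g s != 0;
  null_null : forall s, J s -> ip (derive1 g s) (derive1 g s) = 0;
  null_future : forall s, J s -> future_directed (g s) (derive1 g s);
  null_noinflection : forall s, J s -> wedge (derive1 g s) (derive1n 2 g s) != 0;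
  null_proper_time : forall s, J s -> ip (derive1n 2 g s) (derive1n 2 g s) = 4
}.

Record spinor_frame J (g Fp Fm : R -> 'M[R]_2) : Prop := SpinorFrame {
  spinor_smooth_p : smooth1 J Fp;
  spinor_smooth_m : smooth1 J Fm;
  spinor_SL_p : forall s, J s -> \det (Fp s) = 1;
  spinor_SL_m : forall s, J s -> \det (Fm s) = 1;
  spinor_curve : forall s, J s -> g s = Fp s *m invmx (Fm s);
  spinor_eq_p : forall s, J s ->
    derive1 Fp s = Fp s *m mx22 0 (bending g s + 1) 1 0;
  spinor_eq_m : forall s, J s ->
    derive1 Fm s = Fm s *m mx22 0 (bending g s - 1) 1 0
}.

Definition first_col (F : R -> 'M[R]_2) : R -> 'cV[R]_2 := fun s => col 0 (F s).

Definition det2 (u v : 'cV[R]_2) : R := \det (row_mx u v : 'M[R]_2).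

(* The pair of cousins is well defined only up to a common sign, hence the
   existential quantification over spinor frame fields. *)
Definition cousins J (g : R -> 'M[R]_2) (etap etam : R -> 'cV[R]_2) : Prop :=
  exists Fp Fm : R -> 'M[R]_2,
    [/\ spinor_frame J g Fp Fm, etap = first_col Fp & etam = first_col Fm].

Definition nonzero_constant_on J (h : R -> R) : Prop :=
  exists2 c : R, c != 0 & forall s, J s -> h s = c.

(* T-transforms of each other, for chi = 0. The sign ambiguity of the cousins
   affects neither of the conditions. *)
Definition T_transform_chi0 J (g gt : R -> 'M[R]_2) : Prop :=
  [/\ null_curve J g, null_curve J gt &
   exists etap etam etatp etatm : R -> 'cV[R]_2,
    [/\ cousins J g etap etam, cousins J gt etatp etatm,
        nonzero_constant_on J (fun s => det2 (etap s) (etatp s)),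
        nonzero_constant_on J (fun s => det2 (etam s) (etatm s))
      & forall s, J s ->
          det2 (etap s) (etatp s) * det2 (etam s) (derive1 etatm s)
          - det2 (etam s) (etatm s) * det2 (etap s) (derive1 etatp s) = 0]].

(* The sign is (-1) ^+ b. *)
Definition T_formula (b : bool) (xi f : R) (Fp Fm : 'M[R]_2) : 'M[R]_2 :=
  (-1) ^+ b *:
    (Fp *m mx22 (tanh xi) (- (csch xi * sech xi * f)) 0 (coth xi) *m invmx Fm).

Definition T_transform_with J (xi : R) (f : R -> R) (g gt : R -> 'M[R]_2) :
    Prop :=
  [/\ xi != 0,
      forall s, J s -> derivable f s 1 /\
        derive1 f s + f s ^+ 2 = bending g s + cosh (2 * xi),
      T_transform_chi0 J g gt
    & exists (b : bool) (Fp Fm : R -> 'M[R]_2), spinor_frame J g Fp Fm /\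
        forall s, J s -> gt s = T_formula b xi (f s) (Fp s) (Fm s)].

Definition bending2 (g : R -> R -> 'M[R]_2) : R -> R -> R :=
  fun s t => bending (g^~ t) s.

Record LIEN_solution J I (g : R -> R -> 'M[R]_2) : Prop := LIENSolution {
  LIEN_smooth : smooth2 J I g;
  LIEN_null : forall t, I t -> null_curve J (g^~ t);
  LIEN_eq : forall s t, J s -> I t ->
    partial_t g s t =
      2 *: derive1n 3 (g^~ t) s - (6 * bending2 g s t) *: partial_s g s t
}.

Record spinor_frame2 J I (g Fp Fm : R -> R -> 'M[R]_2) : Prop := SpinorFrame2 {
  spinor2_smooth_p : smooth2 J I Fp;
  spinor2_smooth_m : smooth2 J I Fm;
  spinor2_frame : forall t, I t -> spinor_frame J (g^~ t) (Fp^~ t) (Fm^~ t)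
}.

(* The equation for the total differential of f. *)
Definition Wahlquist_Estabrook J I (lambda : R) (kappa f : R -> R -> R) : Prop :=
  forall s t, J s -> I t ->
    let k := kappa s t in
    let ks := partial_s kappa s t in
    let kss := partial_s (partial_s kappa) s t in
    let x := f s t in
    is_diff (s, t) (fun p : R * R => f p.1 p.2)
      (fun v : R * R =>
         (k - x ^+ 2 + lambda) * v.1 +
         (4 * lambda * (x ^+ 2 - lambda) - 2 * k * (x ^+ 2 + lambda)
          + 2 * k ^+ 2 + 2 * x * ks - kss) * v.2).

Definition Backlund (lambda : R) (kappa f : R -> R -> R) : R -> R -> R :=
  fun s t => - kappa s t + 2 * f s t ^+ 2 - 2 * lambda.

End AntiDeSitter.

(* Main.v *)
Require Import Defs.
From HB Require Import structures.
From mathcomp Require Import all_boot all_order all_algebra.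
From mathcomp Require Import all_classical all_reals all_analysis.
From mathcomp Require Import ring lra.
Import Order.TTheory GRing.Theory Num.Theory.
Import numFieldNormedType.Exports.
Local Open Scope ring_scope.
Local Open Scope classical_set_scope.

(** The curve [gammat] is again a null curve of the flow because each of its two
    spinor frames is a Darboux transform of the corresponding frame of [gamma].

    A cousin [eta] of [gamma] solves [eta'' = (kappa + e) eta], with [e = 1] or
    [e = - 1], and [f] solves the Riccati equation
    [f' = kappa - f^2 + lambda] for both. Classically [eta' - f eta] then solves
    the equation with [kappa] replaced by [- kappa + 2 f^2 - 2 lambda]. In
    terms of the frame this is right multiplication by a matrix [darboux_mx]
    ([is_derive_darboux]), and [det_darboux] says which multiple has
    determinant 1. The quotient of the two Darboux matrices is the
    triangular matrix in the definition of [gammat] ([darboux_conj],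
    [T_formulaE]). Hence the transformed frames are spinor frames along [gammat];
    a curve with spinor frames is null, with the potential as its bending
    ([frame_null_curve], [frame_bending]), and the T-transform conditions are
    read off from the first columns ([det2_first_col]).

    For the flow, write [partial_t F = F P] for the two frames of [gamma]. The
    LIEN equation prescribes the difference of the two matrices [P]
    ([LIEN_frame_difference]), and the equality of mixed partial derivatives
    gives a zero-curvature equation for each ([lax_equation]). Together these
    determine both matrices as polynomials in [kappa] and its first two
    [s]-derivatives ([solve_lax_pair], [LIEN_frame_evolution]). With the
    [dt] part of the Wahlquist--Estabrook equation, the LIEN equation for
    [gammat] then becomes an identity between two-by-two matrices, polynomial in
    [f], [lambda], [kappa] and its derivatives ([darboux_evolution]).

    Both halves need regularity. Smoothness of [gammat] reduces to that of
    [f], which is a bootstrapping argument ([WE_smooth2]); the symmetry of mixed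
    partial derivatives is Schwarz's theorem ([mixed_derivatives]). *)

Set Implicit Arguments.
Unset Strict Implicit.
Unset Printing Implicit Defensive.

(** * Derivatives of matrix-valued maps *)

Section MatrixCalculus.
Context {R : realType}.

Section Entrywise.
Context {V : normedModType R}.

Lemma is_derive_mxP m n (M : V -> 'M[R]_(m, n)) t v (D : 'M[R]_(m, n)) :
  is_derive t v M D <-> forall i j, is_derive t v (fun x => M x i j) (D i j).
Proof.
split=> [[dM <-] i j|dM].
  rewrite derive_mx// mxE; apply: derivableP.
  by move/derivable_mxP: dM; exact.
have drM : derivable M t v.
  by apply/derivable_mxP => i j; have [] := dM i j.
apply: DeriveDef => //; rewrite derive_mx//; apply/matrixP => i j.
by rewrite mxE; have [_ ->] := dM i j.
Qed.

Lemma is_derive_mulmx m n p (A : V -> 'M[R]_(m, n)) (B : V -> 'M[R]_(n, p))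
    t v dA dB :
  is_derive t v A dA -> is_derive t v B dB ->
  is_derive t v (fun x => A x *m B x) (dA *m B t + A t *m dB).
Proof.
move=> /is_derive_mxP hA /is_derive_mxP hB; apply/is_derive_mxP => i j.
have -> : (fun x => (A x *m B x) i j) =
    \sum_k ((fun x => A x i k) * (fun x => B x k j)).
  by apply/funext => x; rewrite mxE fct_sumE.
apply: (@is_derive_eq _ _ _ _ _ _ _
  (\sum_k (A t i k *: dB k j + B t k j *: dA i k))).
  by apply: is_derive_sum => k; exact: is_deriveM.
rewrite !mxE -big_split/=; apply: eq_bigr => k _.
by rewrite addrC [_ *: dA i k]mulrC.
Qed.

End Entrywise.

Lemma continuous_mx {T : topologicalType} m n (M : T -> 'M[R]_(m, n)) (x : T) :
  (forall i j, {for x, continuous (fun y => M y i j)}) ->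
  {for x, continuous M}.
Proof.
move=> cM B [P MP PB]; apply: (@filterS _ _ _ _ _ (fun y => PB (M y))).
apply: filter_forall => i; apply: filter_forall => j.
exact: (cM i j _ (MP i j)).
Qed.

Lemma continuous_mx_entry {T : topologicalType} m n (M : T -> 'M[R]_(m, n))
    (x : T) i j :
  {for x, continuous M} -> {for x, continuous (fun y => M y i j)}.
Proof.
move=> cM; apply: (@continuous_comp _ _ _ M (fun N : 'M[R]_(m, n) => N i j)) => //.
exact: coord_continuous.
Qed.

End MatrixCalculus.

(** * Functions of class C^k in two variables *)

Section Smooth2.
Context {R : realType} (J I : set R) (oJ : open J) (oI : open I).

Lemma near_open (A : set R) (P : R -> Prop) (x : R) :
  open A -> A x -> (forall y, A y -> P y) -> \near x, P x.
Proof. by move=> oA Ax AP; near do apply: AP; exact: open_nbhs_nbhs.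
Unshelve. all: by end_near. Qed.

Section Normed.
Context {V : normedModType R}.
Implicit Types g h : R -> R -> V.

Lemma is_derive1P (g : R -> V) (s : R) (d : V) :
  is_derive s 1 g d <-> derivable g s 1 /\ derive1 g s = d.
Proof.
by split=> [[dg <-]|[dg <-]]; [rewrite derive1E | split => //; rewrite derive1E].
Qed.

Lemma Ck2_continuous k g s t : Ck2 k J I g -> J s -> I t ->
  {for (s, t), continuous (fun p : R * R => g p.1 p.2)}.
Proof. by case: k => [|k] [+ _]; apply. Qed.

Lemma is_derive_partial_s k g (s t : R) : Ck2 k.+1 J I g -> J s -> I t ->
  is_derive s 1 (g^~ t) (partial_s g s t).
Proof.
by move=> [_ [ds _ _ _]] Js It; apply/is_derive1P; split => //; exact: ds.
Qed.

Lemma is_derive_partial_t k g (s t : R) : Ck2 k.+1 J I g -> J s -> I t ->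
  is_derive t 1 (g s) (partial_t g s t).
Proof.
by move=> [_ [_ dt _ _]] Js It; apply/is_derive1P; split => //; exact: dt.
Qed.

Lemma Ck2_weaken k g : Ck2 k.+1 J I g -> Ck2 k J I g.
Proof.
elim: k g => [|k IHk] g; first by move=> [].
move=> [cg [ds dt gs gt]].
exact: (conj cg (And4 ds dt (IHk _ gs) (IHk _ gt))).
Qed.

(** Curves and maps are total functions that are only meaningful on [J] and
    [J x I]; since these are open, equality there is all that partial
    derivatives can see. The lemmas [agree_partial_s], [agree_partial_t] and
    [Ck2_ext] make that usable. *)
Definition agree g h := forall s t, J s -> I t -> g s t = h s t.

Lemma agree_partial_s g h : agree g h -> agree (partial_s g) (partial_s h).
Proof.
move=> gh s t Js It; rewrite /partial_s !derive1E.
by apply: near_eq_derive; apply: near_open Js _ => // y Jy; exact: gh.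
Qed.

Lemma agree_partial_t g h : agree g h -> agree (partial_t g) (partial_t h).
Proof.
move=> gh s t Js It; rewrite /partial_t !derive1E.
by apply: near_eq_derive; apply: near_open It _ => // y Iy; exact: gh.
Qed.

Lemma near_open2 s t : J s -> I t -> \forall p \near (s, t), J p.1 /\ I p.2.
Proof.
move=> Js It; exists (J, I); first by split; exact: open_nbhs_nbhs.
by move=> p.
Qed.

Lemma Ck2_0_ext g h : agree g h -> Ck2 0 J I g -> Ck2 0 J I h.
Proof.
move=> gh Cg; split=> // s t Js It.
have := Ck2_continuous Cg Js It.
rewrite /prop_for /continuous_at /= gh//; apply: cvg_trans.
apply: near_eq_cvg; apply: filterS (near_open2 Js It) => p [Jp Ip].
exact: gh.
Qed.

Lemma Ck2_ext k g h : agree g h -> Ck2 k J I g -> Ck2 k J I h.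
Proof.
elim: k g h => [|k IHk] g h gh Cg; first exact: Ck2_0_ext Cg.
case: Cg => [cg [ds dt gs gt]]; split.
  by have [] : Ck2 0 J I h by exact: Ck2_0_ext (conj cg Logic.I).
split.
- move=> s t Js It; apply: near_eq_derivable (ds s t Js It).
  by apply: near_open Js _ => // y Jy; exact: gh.
- move=> s t Js It; apply: near_eq_derivable (dt s t Js It).
  by apply: near_open It _ => // y Iy; exact: gh.
- by apply: IHk gs; exact: agree_partial_s.
- by apply: IHk gt; exact: agree_partial_t.
Qed.

(** A C^k.+1 function is recognized from any formulas [gs], [gt] for its
    partial derivatives on [J x I], so closure of [Ck2] under an operation
    follows by induction from the matching differentiation rule. *)
Lemma Ck2_intro k g gs gt : Ck2 0 J I g ->
  (forall s t : R, J s -> I t -> is_derive s 1 (g^~ t) (gs s t)) ->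
  (forall s t : R, J s -> I t -> is_derive t 1 (g s) (gt s t)) ->
  Ck2 k J I gs -> Ck2 k J I gt -> Ck2 k.+1 J I g.
Proof.
move=> [cg _] dgs dgt Cgs Cgt; split=> //; split.
- by move=> s t Js It; case: (dgs s t Js It).
- by move=> s t Js It; case: (dgt s t Js It).
- by apply: Ck2_ext Cgs => s t Js It; have /is_derive1P[_ <-] := dgs s t Js It.
- by apply: Ck2_ext Cgt => s t Js It; have /is_derive1P[_ <-] := dgt s t Js It.
Qed.

Lemma Ck2_partial_s k g : Ck2 k.+1 J I g -> Ck2 k J I (partial_s g).
Proof. by move=> [_ []]. Qed.

Lemma Ck2_partial_t k g : Ck2 k.+1 J I g -> Ck2 k J I (partial_t g).
Proof. by move=> [_ []]. Qed.

Lemma smooth2_partial_s g : smooth2 J I g -> smooth2 J I (partial_s g).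
Proof. by move=> Cg k; exact: Ck2_partial_s (Cg k.+1). Qed.

Lemma smooth2_partial_t g : smooth2 J I g -> smooth2 J I (partial_t g).
Proof. by move=> Cg k; exact: Ck2_partial_t (Cg k.+1). Qed.

Lemma derive1n_partial_s n g s t :
  derive1n n (g^~ t) s = iter n partial_s g s t.
Proof.
have E u : derive1n n (g^~ u) = (iter n partial_s g)^~ u.
  by elim: n => [//|n IHn]; rewrite derive1nS IHn.
by rewrite E.
Qed.

(** Along [s] the iterated derivatives of a slice are the iterated partial
    derivatives of the whole map. *)
Lemma smooth2_slice g t : smooth2 J I g -> I t -> smooth1 J (g^~ t).
Proof.
move=> Cg It n s Js.
have -> : derive1n n (g^~ t) = (iter n partial_s g)^~ t.
  by apply/funext => u; exact: derive1n_partial_s.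
have Cn : smooth2 J I (iter n partial_s g).
  by elim: n => [//|n IHn] /=; exact: smooth2_partial_s.
by case: (is_derive_partial_s (Cn 1%N) Js It).
Qed.

Lemma Ck2_cst k (c : V) : Ck2 k J I (fun _ _ => c).
Proof.
elim: k c => [|k IHk] c; first by split=> // s t _ _; exact: cst_continuous.
have C0 : Ck2 0 J I (fun _ _ => c).
  by split=> // s t _ _; exact: cst_continuous.
by apply: (Ck2_intro C0 _ _ (IHk 0) (IHk 0)) => s t _ _; exact: is_derive_cst.
Qed.

Lemma Ck2_add k g h : Ck2 k J I g -> Ck2 k J I h ->
  Ck2 k J I (fun s t => g s t + h s t).
Proof.
elim: k g h => [|k IHk] g h Cg Ch.
  split=> // s t Js It.
  exact: cvgD (Ck2_continuous Cg Js It) (Ck2_continuous Ch Js It).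
apply: (@Ck2_intro _ _ (fun s t => partial_s g s t + partial_s h s t)
                       (fun s t => partial_t g s t + partial_t h s t)).
- split=> // s t Js It.
  exact: cvgD (Ck2_continuous Cg Js It) (Ck2_continuous Ch Js It).
- move=> s t Js It; exact: (is_deriveD (is_derive_partial_s Cg Js It)
    (is_derive_partial_s Ch Js It)).
- move=> s t Js It; exact: (is_deriveD (is_derive_partial_t Cg Js It)
    (is_derive_partial_t Ch Js It)).
- by apply: IHk; exact: Ck2_partial_s.
- by apply: IHk; exact: Ck2_partial_t.
Qed.

End Normed.

Lemma Ck2_mul k (g h : R -> R -> R) : Ck2 k J I g -> Ck2 k J I h ->
  Ck2 k J I (fun s t => g s t * h s t).
Proof.
have C0 (u v : R -> R -> R) j : Ck2 j J I u -> Ck2 j J I v ->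
    Ck2 0 J I (fun s t => u s t * v s t).
  move=> Cu Cv; split=> // s t Js It.
  exact: cvgM (Ck2_continuous Cu Js It) (Ck2_continuous Cv Js It).
elim: k g h => [|k IHk] g h Cg Ch; first exact: C0 Cg Ch.
apply: (@Ck2_intro _ _ _
    (fun s t => g s t * partial_s h s t + h s t * partial_s g s t)
    (fun s t => g s t * partial_t h s t + h s t * partial_t g s t)).
- exact: C0 Cg Ch.
- by move=> s t Js It; exact: (is_deriveM (is_derive_partial_s Cg Js It)
    (is_derive_partial_s Ch Js It)).
- by move=> s t Js It; exact: (is_deriveM (is_derive_partial_t Cg Js It)
    (is_derive_partial_t Ch Js It)).
- apply: Ck2_add; apply: IHk; do ?[exact: Ck2_partial_s | exact: Ck2_weaken].
- apply: Ck2_add; apply: IHk; do ?[exact: Ck2_partial_t | exact: Ck2_weaken].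
Qed.

Lemma Ck2_opp k (g : R -> R -> R) : Ck2 k J I g -> Ck2 k J I (fun s t => - g s t).
Proof.
move=> Cg; apply: Ck2_ext (Ck2_mul (Ck2_cst k (-1 : R)) Cg) => s t _ _.
by rewrite mulN1r.
Qed.

Lemma Ck2_exp k (g : R -> R -> R) n : Ck2 k J I g ->
  Ck2 k J I (fun s t => g s t ^+ n).
Proof.
move=> Cg; elim: n => [|n IHn]; first exact: (Ck2_cst k (1 : R)).
by apply: Ck2_ext (Ck2_mul Cg IHn) => s t _ _; rewrite exprS.
Qed.

Lemma Ck2_sum k (T : Type) (r : seq T) (g : T -> R -> R -> R) :
  (forall i, Ck2 k J I (g i)) -> Ck2 k J I (fun s t => \sum_(i <- r) g i s t).
Proof.
move=> Cg; elim: r => [|i r IHr].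
  by apply: Ck2_ext (Ck2_cst k (0 : R)) => s t _ _; rewrite big_nil.
by apply: Ck2_ext (Ck2_add (Cg i) IHr) => s t _ _; rewrite big_cons.
Qed.

Lemma Ck2_mxP k m n (M : R -> R -> 'M[R]_(m.+1, n.+1)) :
  Ck2 k J I M <-> forall i j, Ck2 k J I (fun s t => M s t i j).
Proof.
split.
  elim: k M => [|k IHk] M CM i j.
    split=> // s t Js It.
    exact: continuous_mx_entry (Ck2_continuous CM Js It).
  apply: (@Ck2_intro _ _ _ (fun s t => partial_s M s t i j)
    (fun s t => partial_t M s t i j)).
  - split=> // s t Js It.
    exact: continuous_mx_entry (Ck2_continuous CM Js It).
  - move=> s t Js It.
    by have /is_derive_mxP := is_derive_partial_s CM Js It; apply.
  - move=> s t Js It.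
    by have /is_derive_mxP := is_derive_partial_t CM Js It; apply.
  - by apply: IHk; exact: Ck2_partial_s.
  - by apply: IHk; exact: Ck2_partial_t.
elim: k M => [|k IHk] M CM.
  split=> // s t Js It; apply: continuous_mx => i j.
  exact: Ck2_continuous (CM i j) Js It.
apply: (@Ck2_intro _ _ _
    (fun s t => \matrix_(i, j) partial_s (fun s t => M s t i j) s t)
    (fun s t => \matrix_(i, j) partial_t (fun s t => M s t i j) s t)).
- split=> // s t Js It; apply: continuous_mx => i j.
  exact: Ck2_continuous (CM i j) Js It.
- move=> s t Js It; apply/is_derive_mxP => i j; rewrite mxE.
  exact: is_derive_partial_s (CM i j) Js It.
- move=> s t Js It; apply/is_derive_mxP => i j; rewrite mxE.
  exact: is_derive_partial_t (CM i j) Js It.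
- apply: IHk => i j; apply: Ck2_ext (Ck2_partial_s (CM i j)) => s t _ _.
  by rewrite mxE.
- apply: IHk => i j; apply: Ck2_ext (Ck2_partial_t (CM i j)) => s t _ _.
  by rewrite mxE.
Qed.

Lemma Ck2_mulmx k m n p (A : R -> R -> 'M[R]_(m.+1, n.+1))
    (B : R -> R -> 'M[R]_(n.+1, p.+1)) :
  Ck2 k J I A -> Ck2 k J I B -> Ck2 k J I (fun s t => A s t *m B s t).
Proof.
move=> /Ck2_mxP CA /Ck2_mxP CB; apply/Ck2_mxP => i j.
apply: Ck2_ext (Ck2_sum (index_enum _) (fun l => Ck2_mul (CA i l) (CB l j))).
by move=> s t _ _; rewrite mxE.
Qed.

End Smooth2.
(** * Symmetry of second derivatives *)

Section MixedPartials.
Context {R : realType}.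

Lemma mean_value (f df : R -> R) (a h : R) : 0 < h ->
  (forall x : R, a <= x <= a + h -> is_derive x 1 f (df x)) ->
  exists2 c, a <= c <= a + h & f (a + h) - f a = df c * h.
Proof.
move=> h0 dfx; have lt_ah : a < a + h by rewrite ltrDl.
have [||c] := @MVT R f df a (a + h) lt_ah.
- by move=> x; rewrite in_itv/= => /andP[ax xb]; apply: dfx; rewrite !ltW.
- apply: derivable_within_continuous => x; rewrite in_itv/= => xab.
  by case: (dfx x xab).
- rewrite in_itv/= => /andP[ac cb] E; exists c; first by rewrite !ltW.
  by rewrite E [a + h]addrC addrK.
Qed.

(** Two applications of the mean value theorem, first in [s] and then in [t],
    turn the second difference over a square into a mixed derivative at some
    point of the square. *)
Lemma second_difference (g gs gst : R -> R -> R) (a b h : R) : 0 < h ->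
  (forall s t : R, a <= s <= a + h -> b <= t <= b + h ->
     is_derive s 1 (g^~ t) (gs s t)) ->
  (forall s t : R, a <= s <= a + h -> b <= t <= b + h ->
     is_derive t 1 (gs s) (gst s t)) ->
  exists s t : R, [/\ a <= s <= a + h, b <= t <= b + h &
    g (a + h) (b + h) - g (a + h) b - (g a (b + h) - g a b) = gst s t * h * h].
Proof.
move=> h0 dgs dgst.
have b0 : b <= b <= b + h by rewrite lexx lerDl ltW.
have b1 : b <= b + h <= b + h by rewrite lexx lerDl ltW.
have [s sin E1] : exists2 s, a <= s <= a + h &
    g (a + h) (b + h) - g (a + h) b - (g a (b + h) - g a b)
    = (gs s (b + h) - gs s b) * h.
  apply: (mean_value (f := fun s => g s (b + h) - g s b)
                     (df := fun s => gs s (b + h) - gs s b) h0) => x xin.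
  exact: (is_deriveB (dgs x (b + h) xin b1) (dgs x b xin b0)).
have [t tin E2] := mean_value h0 (fun t tin => dgst s t sin tin).
by exists s, t; split=> //; rewrite E1 E2.
Qed.

Context (J I : set R) (oJ : open J) (oI : open I).

(** Schwarz: on a small square based at (s, t), the second difference is both
    a value of [A] and a value of [B], depending on the variable in which the
    mean value theorem is used first; continuity of [A] and [B] at (s, t) lets
    the square shrink. *)
Lemma mixed_derivatives (g gs gt A B : R -> R -> R) (s t : R) :
  (forall u v : R, J u -> I v -> is_derive u 1 (g^~ v) (gs u v)) ->
  (forall u v : R, J u -> I v -> is_derive v 1 (gs u) (A u v)) ->
  (forall u v : R, J u -> I v -> is_derive v 1 (g u) (gt u v)) ->
  (forall u v : R, J u -> I v -> is_derive u 1 (gt^~ v) (B u v)) ->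
  {for (s, t), continuous (fun p : R * R => A p.1 p.2)} ->
  {for (s, t), continuous (fun p : R * R => B p.1 p.2)} ->
  J s -> I t -> A s t = B s t.
Proof.
move=> dgs dA dgt dB cA cB Js It.
apply/eqP; rewrite -subr_eq0 -normr_eq0 eq_le normr_ge0 andbT.
(* It suffices to bound the difference by an arbitrary e; each of A and B
   contributes e / 2. *)
apply/ler_addgt0Pr => e e0; rewrite add0r.
have e20 : 0 < e / 2 by rewrite divr_gt0.
move/cvgrPdist_lt : cA => /(_ _ e20) nA.
move/cvgrPdist_lt : cB => /(_ _ e20) nB.
have : \forall p \near (s, t), [/\ J p.1, I p.2,
    `|A s t - A p.1 p.2| < e / 2 & `|B s t - B p.1 p.2| < e / 2].
  have FF : Filter (nbhs ((s, t) : R * R)) by exact: nbhs_filter.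
  have nAB := @filterI _ _ FF _ _ nA nB.
  have nall := @filterI _ _ FF _ _ (near_open2 oJ oI Js It) nAB.
  apply: filterS nall => p [[Jp Ip] [pA pB]]; exact: And4 Jp Ip pA pB.
move=> /nbhs_ballP[d /= d0 sub].
set h := d / 2; have h0 : 0 < h by rewrite divr_gt0.
have hd : h < d by rewrite ltr_pdivrMr// ltr_pMr// ltr1n.
have near_h (x y : R) : s <= x <= s + h -> t <= y <= t + h ->
    [/\ J x, I y, `|A s t - A x y| < e / 2 & `|B s t - B x y| < e / 2].
  move=> xin yin; apply: (sub (x, y)).
    by split; rewrite /ball/= distrC ger0_norm ?subr_ge0; lra.
have [x [y [xin yin Exy]]] : exists x y, [/\ s <= x <= s + h, t <= y <= t + h &
    g (s + h) (t + h) - g (s + h) t - (g s (t + h) - g s t) = A x y * h * h].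
  apply: (second_difference (gs := gs) h0) => u v uin vin;
    have [Ju Iv _ _] := near_h u v uin vin; [exact: dgs | exact: dA].
have [y' [x' [yin' xin' Exy']]] : exists y x,
    [/\ t <= y <= t + h, s <= x <= s + h &
    g (s + h) (t + h) - g s (t + h) - (g (s + h) t - g s t) = B x y * h * h].
  apply: (second_difference (g := fun v u => g u v)
      (gs := fun v u => gt u v) (gst := fun v u => B u v) h0) => v u vin uin;
    have [Ju Iv _ _] := near_h u v uin vin; [exact: dgt | exact: dB].
have AB : A x y = B x' y'.
  have hn0 : h != 0 by rewrite gt_eqF.
  apply: (mulIf hn0); apply: (mulIf hn0); rewrite -Exy -Exy'; ring.
have [_ _ dA1 _] := near_h x y xin yin; have [_ _ _ dB1] := near_h x' y' xin' yin'.
rewrite -[A s t - _](subrKA (A x y)) (splitr e) {2}AB.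
by rewrite (le_trans (ler_normD _ _))// lerD ?ltW// distrC.
Qed.

Lemma partialC (g : R -> R -> R) s t : Ck2 2 J I g -> J s -> I t ->
  partial_t (partial_s g) s t = partial_s (partial_t g) s t.
Proof.
move=> Cg Js It.
apply: (mixed_derivatives (g := g) (gs := partial_s g) (gt := partial_t g)
  (A := partial_t (partial_s g)) (B := partial_s (partial_t g)) _ _ _ _ _ _ Js It).
- by move=> u v Ju Iv; exact: is_derive_partial_s Cg Ju Iv.
- by move=> u v Ju Iv; exact: is_derive_partial_t (Ck2_partial_s Cg) Ju Iv.
- by move=> u v Ju Iv; exact: is_derive_partial_t Cg Ju Iv.
- by move=> u v Ju Iv; exact: is_derive_partial_s (Ck2_partial_t Cg) Ju Iv.
- exact: Ck2_continuous (Ck2_partial_t (Ck2_partial_s Cg)) Js It.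
- exact: Ck2_continuous (Ck2_partial_s (Ck2_partial_t Cg)) Js It.
Qed.

Lemma partial_s_entry k m n (M : R -> R -> 'M[R]_(m.+1, n.+1)) i j s t :
  Ck2 k.+1 J I M -> J s -> I t ->
  partial_s M s t i j = partial_s (fun u v => M u v i j) s t.
Proof.
move=> CM Js It; have /is_derive_mxP dM := is_derive_partial_s CM Js It.
by have /is_derive1P[_ E] := dM i j; rewrite -E.
Qed.

Lemma partial_t_entry k m n (M : R -> R -> 'M[R]_(m.+1, n.+1)) i j s t :
  Ck2 k.+1 J I M -> J s -> I t ->
  partial_t M s t i j = partial_t (fun u v => M u v i j) s t.
Proof.
move=> CM Js It; have /is_derive_mxP dM := is_derive_partial_t CM Js It.
by have /is_derive1P[_ E] := dM i j; rewrite -E.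
Qed.

Lemma partialC_mx m n (M : R -> R -> 'M[R]_(m.+1, n.+1)) s t :
  Ck2 2 J I M -> J s -> I t ->
  partial_t (partial_s M) s t = partial_s (partial_t M) s t.
Proof.
move=> CM Js It; apply/matrixP => i j.
have CMij := (Ck2_mxP oJ oI 2 M).1 CM i j.
have entry_s u v : J u -> I v ->
    partial_s M u v i j = partial_s (fun s t => M s t i j) u v.
  exact: partial_s_entry CM.
have entry_t u v : J u -> I v ->
    partial_t M u v i j = partial_t (fun s t => M s t i j) u v.
  exact: partial_t_entry CM.
apply: etrans (partial_t_entry i j (Ck2_partial_s CM) Js It) _.
apply: etrans (agree_partial_t oI entry_s Js It) _.
apply: etrans (partialC CMij Js It) _.
apply: esym; apply: etrans (partial_s_entry i j (Ck2_partial_t CM) Js It) _.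
exact: etrans (agree_partial_s oJ entry_t Js It) _.
Qed.

End MixedPartials.
(** * Two-by-two matrices and the geometry of AdS *)

Section Mx22.
Context {R : realType}.
Implicit Types (a b c d k : R) (X Y N : 'M[R]_2).

Lemma mx22_eta X : X = mx22 (X 0 0) (X 0 1) (X 1 0) (X 1 1).
Proof.
by apply/matrixP => -[[|[|//]] hi] [[|[|//]] hj]; rewrite mxE /=;
  congr (X _ _); apply: val_inj.
Qed.

Lemma mx22E a b c d :
  (mx22 a b c d 0 0 = a) * (mx22 a b c d 0 1 = b) *
  (mx22 a b c d 1 0 = c) * (mx22 a b c d 1 1 = d).
Proof. by rewrite !mxE. Qed.

Lemma mx22P X Y : X 0 0 = Y 0 0 -> X 0 1 = Y 0 1 -> X 1 0 = Y 1 0 ->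
  X 1 1 = Y 1 1 -> X = Y.
Proof. by rewrite [X]mx22_eta [Y]mx22_eta !mx22E => -> -> -> ->. Qed.

Lemma mul_mx22 a b c d a' b' c' d' : mx22 a b c d *m mx22 a' b' c' d' =
  mx22 (a * a' + b * c') (a * b' + b * d') (c * a' + d * c') (c * b' + d * d').
Proof. by apply: mx22P; rewrite !mxE !big_ord_recl big_ord0 addr0 !mxE. Qed.

Lemma add_mx22 a b c d a' b' c' d' : mx22 a b c d + mx22 a' b' c' d' =
  mx22 (a + a') (b + b') (c + c') (d + d').
Proof. by apply: mx22P; rewrite !mxE. Qed.

Lemma opp_mx22 a b c d : - mx22 a b c d = mx22 (- a) (- b) (- c) (- d).
Proof. by apply: mx22P; rewrite !mxE. Qed.

Lemma scale_mx22 k a b c d : k *: mx22 a b c d = mx22 (k * a) (k * b) (k * c) (k * d).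
Proof. by apply: mx22P; rewrite !mxE. Qed.

Lemma scalar_mx22 k : k%:M = mx22 k 0 0 k.
Proof. by apply: mx22P; rewrite !mxE. Qed.

Definition mx22_arith :=
  (mul_mx22, add_mx22, opp_mx22, scale_mx22, scalar_mx22).

Lemma det22 X : \det X = X 0 0 * X 1 1 - X 0 1 * X 1 0.
Proof.
rewrite (expand_det_row _ 0) !big_ord_recl big_ord0 addr0 /cofactor !det_mx11 !mxE.
rewrite /= expr0 expr1 mul1r mulN1r mulrN.
by congr (X _ _ * X _ _ - X _ _ * X _ _); apply: val_inj.
Qed.

Lemma det_mx22 a b c d : \det (mx22 a b c d) = a * d - b * c.
Proof. by rewrite det22 !mx22E. Qed.

(** The adjugate. On SL(2) it is the inverse, but unlike the inverse it is
    linear in the matrix, which makes its derivative immediate. *)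
Definition adj2 X : 'M[R]_2 := mx22 (X 1 1) (- X 0 1) (- X 1 0) (X 0 0).

Lemma mul_mx_adj2 X : X *m adj2 X = (\det X)%:M.
Proof. by rewrite det22 {1}[X]mx22_eta !mx22_arith; congr mx22; ring. Qed.

Lemma mul_adj2_mx X : adj2 X *m X = (\det X)%:M.
Proof. by rewrite det22 {2}[X]mx22_eta !mx22_arith; congr mx22; ring. Qed.

Lemma adj2M X Y : adj2 (X *m Y) = adj2 Y *m adj2 X.
Proof.
rewrite [X]mx22_eta [Y]mx22_eta mul_mx22 /adj2 !mx22E mul_mx22.
by congr mx22; ring.
Qed.

Lemma adj2Z k X : adj2 (k *: X) = k *: adj2 X.
Proof. by rewrite [X]mx22_eta scale_mx22 /adj2 !mx22E scale_mx22 !mulrN. Qed.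

Lemma det_adj2 X : \det (adj2 X) = \det X.
Proof. by rewrite /adj2 det_mx22 det22; ring. Qed.

Lemma adj2_traceless X : \tr X = 0 -> adj2 X = - X.
Proof.
rewrite /mxtrace !big_ord_recl big_ord0 addr0 => /eqP.
rewrite (_ : lift ord0 ord0 = 1); last exact: val_inj.
rewrite addr_eq0 => /eqP E; rewrite [X in - X]mx22_eta opp_mx22 /adj2.
by rewrite [X 0 0]E opprK.
Qed.

Lemma invmx_SL2 X : \det X = 1 -> invmx X = adj2 X.
Proof.
move=> dX; have uX : X \in unitmx by rewrite unitmxE dX unitr1.
by rewrite -[RHS](mulKmx uX) mul_mx_adj2 dX mulmx1.
Qed.

Lemma ip_diag X : ip X X = - \det X.
Proof. by rewrite /ip !det22 !mxE; field. Qed.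

Lemma sandwich_inj X Y N N' : \det X = 1 -> \det Y = 1 ->
  X *m N *m adj2 Y = X *m N' *m adj2 Y -> N = N'.
Proof.
move=> dX dY E; have := congr1 (fun Z => adj2 X *m Z *m Y) E.
by rewrite !mulmxA mul_adj2_mx dX !mul1mx -!mulmxA mul_adj2_mx dY !mulmx1.
Qed.

Lemma is_derive_mx22 (V : normedModType R) (a b c d : V -> R) t v da db dc dd :
  is_derive t v a da -> is_derive t v b db -> is_derive t v c dc ->
  is_derive t v d dd ->
  is_derive t v (fun x => mx22 (a x) (b x) (c x) (d x)) (mx22 da db dc dd).
Proof.
move=> ha hb hc hd; apply/is_derive_mxP => i j.
rewrite (_ : (fun x => _) = if i == 0 then if j == 0 then a else b
  else if j == 0 then c else d).
  by rewrite mxE; case: ifP => _; case: ifP => _.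
by apply/funext => x; rewrite mxE; case: ifP => _; case: ifP.
Qed.

Lemma is_derive_adj2 (V : normedModType R) (F : V -> 'M[R]_2) t v dF :
  is_derive t v F dF -> is_derive t v (fun x => adj2 (F x)) (adj2 dF).
Proof.
move=> /is_derive_mxP hF.
by apply: is_derive_mx22; do ?apply: is_deriveN; exact: hF.
Qed.

(** The product rule behind every computation below. Maps into AdS and their
    derivatives all have the shape [F N G^-1], and differentiation acts on the
    middle factor alone, by [N |-> A N + N' - N B], because
    [(G^-1)' = - B G^-1]; here [- B] is the adjugate of the traceless [B]. *)
Lemma is_derive_sandwich (V : normedModType R) (F G N : V -> 'M[R]_2) t v A B dN :
  is_derive t v F (F t *m A) -> is_derive t v G (G t *m B) ->
  is_derive t v N dN -> \tr B = 0 ->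
  is_derive t v (fun x => F x *m N x *m adj2 (G x))
    (F t *m (A *m N t + dN - N t *m B) *m adj2 (G t)).
Proof.
move=> hF hG hN trB.
have := is_derive_mulmx (is_derive_mulmx hF hN) (is_derive_adj2 hG).
move=> /is_derive_eq; apply.
rewrite adj2M (adj2_traceless trB) mulNmx mulmxN mulmxBr mulmxDr mulmxBl !mulmxA.
by [].
Qed.

Lemma det_sandwich X N Y : \det X = 1 -> \det Y = 1 ->
  \det (X *m N *m adj2 Y) = \det N.
Proof. by move=> dX dY; rewrite !det_mulmx det_adj2 dX dY mul1r mulr1. Qed.

(** The velocity in a spinor frame is future-directed because the relevant
    inner product is half the sum of the squared Euclidean norms of the first
    columns of [X] and [Y], that is, of the cousins. *)
Lemma future_sandwich X Y : \det X = 1 -> \det Y = 1 ->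
  future_directed (X *m adj2 Y) (X *m mx22 0 2 0 0 *m adj2 Y).
Proof.
move=> dX dY; rewrite /future_directed.
suff -> : wedge_ip 1%:M Jmx (X *m adj2 Y) (X *m mx22 0 2 0 0 *m adj2 Y) =
    (\det Y * (X 0 0 ^+ 2 + X 1 0 ^+ 2) + \det X * (Y 0 0 ^+ 2 + Y 1 0 ^+ 2)) / 2.
  rewrite dX dY !mul1r divr_gt0 ?ltr0n//.
  have [X0|X0] := eqVneq (X 0 0) 0; last first.
    rewrite -addrA ltr_pwDl ?addr_ge0 ?sqr_ge0//.
    by rewrite lt_neqAle sqr_ge0 andbT eq_sym sqrf_eq0.
  rewrite [X 0 0 ^+ 2 + _]addrC -addrA ltr_pwDl ?addr_ge0 ?sqr_ge0//.
  rewrite lt_neqAle sqr_ge0 andbT eq_sym sqrf_eq0; apply: contra_eq_neq dX.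
  by move=> X1; rewrite det22 X0 X1 mul0r mulr0 subr0 eq_sym oner_neq0.
rewrite /wedge_ip /ip /Jmx [X]mx22_eta [Y]mx22_eta /adj2 !mx22E !mx22_arith !det_mx22.
by field.
Qed.

(** If the wedge product vanished, [Y] would be a multiple of the nonzero
    [X], hence singular as well. *)
Lemma wedge_neq0 X Y : X != 0 -> \det X = 0 -> \det Y != 0 -> wedge X Y != 0.
Proof.
move=> X0 dX; apply: contraNneq => W0.
have E (i j p q : 'I_2) : X i j * Y p q = Y i j * X p q.
  have := congr1 (fun M : 'M[R]_(2 * 2)%N => M (mxvec_index i j) (mxvec_index p q)) W0.
  rewrite !mxE !big_ord1 !mxE !mxvecE => /eqP; rewrite subr_eq0 => /eqP.
  by [].
have [i [j Xij]] : exists i j, X i j != 0.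
  apply: contrapT => H; move/eqP : X0; apply; apply/matrixP => i j; rewrite mxE.
  by apply: contrapT => /eqP Xij; apply: H; exists i, j.
have -> : Y = (Y i j / X i j) *: X.
  by apply/matrixP => p q; rewrite mxE mulrAC -E mulrC mulKf.
by rewrite detZ dX mulr0.
Qed.

End Mx22.
(** * Null curves from spinor frames *)

Section Frames.
Context {R : realType} (J : set R) (oJ : open J).
Context (F G g : R -> 'M[R]_2) (k : R -> R).
Hypothesis dF : forall s : R, J s -> is_derive s 1 F (F s *m mx22 0 (k s + 1) 1 0).
Hypothesis dG : forall s : R, J s -> is_derive s 1 G (G s *m mx22 0 (k s - 1) 1 0).
Hypothesis detF : forall s, J s -> \det (F s) = 1.
Hypothesis detG : forall s, J s -> \det (G s) = 1.

Lemma is_derive_sandwich_cst (h : R -> 'M[R]_2) N :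
  (forall s, J s -> h s = F s *m N *m adj2 (G s)) ->
  forall s : R, J s -> is_derive s 1 h
    (F s *m (mx22 0 (k s + 1) 1 0 *m N - N *m mx22 0 (k s - 1) 1 0) *m adj2 (G s)).
Proof.
move=> hE s Js.
apply: (@near_eq_is_derive _ _ _ (fun x => F x *m N *m adj2 (G x))).
  by apply: near_open Js _ => // x Jx; rewrite hE.
have trG : \tr (mx22 0 (k s - 1) 1 0) = 0.
  by rewrite /mxtrace !big_ord_recl big_ord0 !mxE /= !addr0.
have := is_derive_sandwich (dF Js) (dG Js) (is_derive_cst N s 1) trG.
by rewrite addr0.
Qed.

Hypothesis gE : forall s, J s -> g s = F s *m adj2 (G s).

(** Differentiating [F G^-1] kills [k]: the two coefficient matrices
    differ by a constant nilpotent matrix. *)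
Lemma frame_velocity s : J s -> derive1 g s = F s *m mx22 0 2 0 0 *m adj2 (G s).
Proof.
move=> Js; have gE1 x : J x -> g x = F x *m 1%:M *m adj2 (G x).
  by move=> Jx; rewrite mulmx1 gE.
have /is_derive1P[_ ->] := is_derive_sandwich_cst gE1 Js.
by rewrite mulmx1 mul1mx !mx22_arith; congr (_ *m mx22 _ _ _ _ *m _); ring.
Qed.

Lemma frame_acceleration s : J s ->
  derive1n 2 g s = F s *m mx22 (-2) 0 0 2 *m adj2 (G s).
Proof.
move=> Js; rewrite derive1nS derive1n1.
have /is_derive1P[_ ->] := is_derive_sandwich_cst frame_velocity Js.
by rewrite !mx22_arith; congr (_ *m mx22 _ _ _ _ *m _); ring.
Qed.

Lemma frame_jerk s : J s ->
  derive1n 3 g s = F s *m mx22 0 (4 * k s) (-4) 0 *m adj2 (G s).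
Proof.
move=> Js; rewrite derive1nS.
have /is_derive1P[_ ->] := is_derive_sandwich_cst frame_acceleration Js.
by rewrite !mx22_arith; congr (_ *m mx22 _ _ _ _ *m _); ring.
Qed.

(** The third derivative [F N G^-1] has determinant [det N = 16 k], so the
    potential of the frame equations is the bending of the curve. *)
Lemma frame_bending s : J s -> bending g s = k s.
Proof.
move=> Js; rewrite /bending frame_jerk// ip_diag det_sandwich ?detF ?detG//.
by rewrite det_mx22; field.
Qed.

(** The right-hand side of the LIEN flow involves no derivative of the
    bending once it is written in the frame. *)
Lemma frame_LIEN_velocity s : J s ->
  2 *: derive1n 3 g s - (6 * bending g s) *: derive1 g s =
  F s *m mx22 0 (- 4 * k s) (- 8) 0 *m adj2 (G s).
Proof.
move=> Js; rewrite frame_bending// frame_jerk// frame_velocity//.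
rewrite scalemxAl [X in _ - X]scalemxAl -mulmxBl !scalemxAr -mulmxBr !mx22_arith.
by congr (_ *m mx22 _ _ _ _ *m _); ring.
Qed.

(** The conditions on the velocity and the acceleration, apart from the future
    direction, are read off from the middle factors of the first two
    derivatives. *)
Lemma frame_null_curve : smooth1 J g -> null_curve J g.
Proof.
move=> Cg.
have det_velocity s : J s -> \det (derive1 g s) = 0.
  by move=> Js; rewrite frame_velocity// det_sandwich ?detF ?detG// det_mx22; ring.
have det_acceleration s : J s -> \det (derive1n 2 g s) = -4.
  by move=> Js; rewrite frame_acceleration// det_sandwich ?detF ?detG// det_mx22; ring.
have velocity_neq0 s : J s -> derive1 g s != 0.
  move=> Js; apply/eqP => g0.
  have := @sandwich_inj _ (F s) (G s) (mx22 0 2 0 0) 0 (detF Js) (detG Js).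
  rewrite -frame_velocity// g0 mulmx0 mul0mx => /(_ erefl).
  move=> /(congr1 (fun M : 'M[R]_2 => M 0 1)).
  by rewrite !mxE /= => /eqP; rewrite pnatr_eq0.
split=> // s Js.
- by rewrite /AdS gE// det_mulmx det_adj2 detF// detG// mulr1.
- by rewrite ip_diag det_velocity// oppr0.
- by rewrite frame_velocity// gE//; apply: future_sandwich; [exact: detF|exact: detG].
- apply: wedge_neq0; [exact: velocity_neq0 | exact: det_velocity |].
  by rewrite det_acceleration// oppr_eq0 pnatr_eq0.
- by rewrite ip_diag det_acceleration// opprK.
Qed.

End Frames.
(** * Time evolution of a spinor frame *)

Section Evolution.
Context {R : realType} (J I : set R) (oJ : open J) (oI : open I).

Lemma smooth2_det22 (M : R -> R -> 'M[R]_2) :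
  smooth2 J I M -> smooth2 J I (fun s t => \det (M s t)).
Proof.
move=> CM k; have CMij := (Ck2_mxP oJ oI k M).1 (CM k).
have C := Ck2_add oJ oI (Ck2_mul oJ oI (CMij 0 0) (CMij 1 1))
  (Ck2_opp oJ oI (Ck2_mul oJ oI (CMij 0 1) (CMij 1 0))).
by apply: (Ck2_ext oJ oI _ C) => s t _ _; rewrite det22.
Qed.

Lemma smooth2_mx22 (a b c d : R -> R -> R) :
  smooth2 J I a -> smooth2 J I b -> smooth2 J I c -> smooth2 J I d ->
  smooth2 J I (fun s t => mx22 (a s t) (b s t) (c s t) (d s t)).
Proof.
move=> Ca Cb Cc Cd k; apply/(Ck2_mxP oJ oI) => i j.
have C : Ck2 k J I (if i == 0 then if j == 0 then a else b
  else if j == 0 then c else d) by case: ifP => _; case: ifP.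
by apply: (Ck2_ext oJ oI _ C) => s t _ _; rewrite mxE; case: ifP => _; case: ifP.
Qed.

Lemma smooth2_adj2 (M : R -> R -> 'M[R]_2) :
  smooth2 J I M -> smooth2 J I (fun s t => adj2 (M s t)).
Proof.
move=> CM; have CMij i j : smooth2 J I (fun s t => M s t i j).
  by move=> k; exact: (Ck2_mxP oJ oI k M).1 (CM k) i j.
by apply: smooth2_mx22 => // k; apply: (Ck2_opp oJ oI); exact: CMij.
Qed.

Lemma smooth2_mulmx (M N : R -> R -> 'M[R]_2) :
  smooth2 J I M -> smooth2 J I N -> smooth2 J I (fun s t => M s t *m N s t).
Proof. by move=> CM CN k; exact: Ck2_mulmx oJ oI _ _ _ _ _ _ (CM k) (CN k). Qed.

(** The bending is a determinant of third derivatives, up to a constant. *)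
Lemma smooth2_bending (g : R -> R -> 'M[R]_2) :
  smooth2 J I g -> smooth2 J I (bending2 g).
Proof.
move=> Cg k.
have C3 : smooth2 J I (iter 3 partial_s g).
  by do 3!apply: smooth2_partial_s.
have C := Ck2_mul oJ oI (smooth2_det22 C3 k) (Ck2_cst oJ oI k (16^-1 : R)).
apply: (Ck2_ext oJ oI _ C).
move=> s t _ _; rewrite /bending2 /bending ip_diag opprK.
by rewrite (derive1n_partial_s 3 g).
Qed.

(** Jacobi's formula. *)
Lemma is_derive_det22 (M : R -> 'M[R]_2) (t : R) dM :
  is_derive t 1 M dM -> is_derive t 1 (fun x => \det (M x)) (\tr (adj2 (M t) *m dM)).
Proof.
move=> /is_derive_mxP dMij.
rewrite (_ : (fun x => _) =
    (fun x => M x 0 0 * M x 1 1 - M x 0 1 * M x 1 0)); last first.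
  by apply/funext => x; rewrite det22.
have := is_deriveB (is_deriveM (dMij 0 0) (dMij 1 1))
  (is_deriveM (dMij 0 1) (dMij 1 0)).
move=> /is_derive_eq; apply.
rewrite [dM]mx22_eta /adj2 mul_mx22 /mxtrace !big_ord_recl big_ord0 !mxE /=.
by rewrite /GRing.scale/=; ring.
Qed.

Section OneFrame.
Context (kappa : R -> R -> R) (e : R) (F : R -> R -> 'M[R]_2).
Hypothesis Ck : smooth2 J I kappa.
Hypothesis CF : smooth2 J I F.
Hypothesis detF : forall s t, J s -> I t -> \det (F s t) = 1.
Hypothesis F_s : forall s t, J s -> I t ->
  partial_s F s t = F s t *m mx22 0 (kappa s t + e) 1 0.

(** The matrix [P] with [partial_t M = M P], when [M] takes values in SL(2). *)
Definition log_t_derivative (M : R -> R -> 'M[R]_2) : R -> R -> 'M[R]_2 :=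
  fun s t => adj2 (M s t) *m partial_t M s t.

Let P := log_t_derivative F.

Lemma smooth2_log_t_derivative : smooth2 J I P.
Proof.
by apply: smooth2_mulmx; [exact: smooth2_adj2 | exact: smooth2_partial_t].
Qed.

Lemma partial_t_frame s t : J s -> I t -> partial_t F s t = F s t *m P s t.
Proof.
by move=> Js It; rewrite /P /log_t_derivative mulmxA mul_mx_adj2 detF// mul1mx.
Qed.

(** The curve [F s] stays in SL(2), so [P] stays in its Lie algebra. *)
Lemma log_t_derivative_traceless s t : J s -> I t -> P s t 1 1 = - P s t 0 0.
Proof.
move=> Js It.
have /is_derive1P[_ E] := is_derive_det22 (is_derive_partial_t (CF 1) Js It).
have : is_derive t 1 (fun x => \det (F s x)) 0.
  apply: near_eq_is_derive (is_derive_cst (1 : R) t 1).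
  by apply: near_open It _ => // x Ix; rewrite detF.
move=> /is_derive1P[_]; rewrite E /mxtrace !big_ord_recl big_ord0 addr0.
rewrite (_ : lift ord0 ord0 = 1); last exact: val_inj.
by move=> /eqP; rewrite addrC addr_eq0 => /eqP.
Qed.

(** The zero-curvature equation: it is the equality of the mixed partial
    derivatives of [F], with [F] cancelled. *)
Lemma lax_equation s t : J s -> I t -> partial_s P s t =
  P s t *m mx22 0 (kappa s t + e) 1 0 - mx22 0 (kappa s t + e) 1 0 *m P s t
  + mx22 0 (partial_t kappa s t) 0 0.
Proof.
move=> Js It; set A := mx22 0 _ 1 0.
have Ft : is_derive t 1 (F s) (F s t *m P s t).
  by rewrite -partial_t_frame//; exact: is_derive_partial_t (CF 1) Js It.
have Fs : is_derive s 1 (F^~ t) (F s t *m A).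
  by rewrite -F_s//; exact: is_derive_partial_s (CF 1) Js It.
have Ps : is_derive s 1 (P^~ t) (partial_s P s t).
  exact: is_derive_partial_s (smooth2_log_t_derivative 1) Js It.
have At : is_derive t 1 (fun t => mx22 0 (kappa s t + e) 1 0)
    (mx22 0 (partial_t kappa s t) 0 0).
  apply: is_derive_mx22; try exact: is_derive_cst.
  have := is_deriveD (is_derive_partial_t (Ck 1) Js It) (is_derive_cst e t 1).
  by rewrite addr0.
have /is_derive1P[_ E1] := is_derive_mulmx Fs Ps.
have /is_derive1P[_ E2] := is_derive_mulmx Ft At.
have : F s t *m A *m P s t + F s t *m partial_s P s t =
    F s t *m P s t *m A + F s t *m mx22 0 (partial_t kappa s t) 0 0.
  rewrite -E1 -E2.
  apply: etrans (esym (agree_partial_s oJ partial_t_frame Js It)) _.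
  apply: etrans (esym (partialC_mx oJ oI (CF 2) Js It)) _.
  exact: etrans (agree_partial_t oI F_s Js It) _.
move=> /(congr1 (mulmx (adj2 (F s t)))).
rewrite !mulmxDr !mulmxA !mul_adj2_mx detF// !mul1mx => E.
by rewrite addrAC -E addrAC addrN add0r.
Qed.

(** Only the first column of the zero-curvature equation is kept: it does not
    involve the time derivative of [kappa], and it is enough to determine [P]
    together with the LIEN flow. *)
Lemma lax_entries s t : J s -> I t ->
  partial_s (fun s t => P s t 0 0) s t = P s t 0 1 - (kappa s t + e) * P s t 1 0 /\
  partial_s (fun s t => P s t 1 0) s t = - 2 * P s t 0 0.
Proof.
move=> Js It; have C1 := smooth2_log_t_derivative 1.
rewrite -!(partial_s_entry _ _ C1 Js It) lax_equation// [P s t]mx22_eta.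
rewrite log_t_derivative_traceless// !mx22_arith !mx22E.
by split; ring.
Qed.

End OneFrame.

Section TwoFrames.
Context (kappa : R -> R -> R) (P Q : R -> R -> 'M[R]_2).
Hypothesis Ck : smooth2 J I kappa.
Hypothesis trP : forall s t, J s -> I t -> P s t 1 1 = - P s t 0 0.
Hypothesis trQ : forall s t, J s -> I t -> Q s t 1 1 = - Q s t 0 0.
Hypothesis laxP : forall s t, J s -> I t ->
  partial_s (fun s t => P s t 0 0) s t = P s t 0 1 - (kappa s t + 1) * P s t 1 0 /\
  partial_s (fun s t => P s t 1 0) s t = - 2 * P s t 0 0.
Hypothesis laxQ : forall s t, J s -> I t ->
  partial_s (fun s t => Q s t 0 0) s t = Q s t 0 1 - (kappa s t - 1) * Q s t 1 0 /\
  partial_s (fun s t => Q s t 1 0) s t = - 2 * Q s t 0 0.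
Hypothesis PQ : forall s t, J s -> I t ->
  P s t - Q s t = mx22 0 (- 4 * kappa s t) (- 8) 0.

Let ks := partial_s kappa.
Let kss := partial_s (partial_s kappa).

(** The zero-curvature equations of the two frames share their upper left
    entry since [P] and [Q] do; equating the right-hand sides gives the lower
    left entry of [P], whose derivative gives the diagonal, whose derivative in
    turn gives the upper right entry. *)
Lemma solve_lax_pair : forall s t, J s -> I t ->
  P s t = mx22 (- ks s t)
    (- kss s t + 2 * kappa s t ^+ 2 - 2 * kappa s t - 4)
    (2 * kappa s t - 4) (ks s t) /\
  Q s t = mx22 (- ks s t)
    (- kss s t + 2 * kappa s t ^+ 2 + 2 * kappa s t - 4)
    (2 * kappa s t + 4) (ks s t).
Proof.
have Qe s t : J s -> I t -> [/\ Q s t 0 0 = P s t 0 0,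
    Q s t 0 1 = P s t 0 1 + 4 * kappa s t & Q s t 1 0 = P s t 1 0 + 8].
  move=> Js It; have E := PQ Js It.
  have E00 := congr1 (fun M : 'M[R]_2 => M 0 0) E.
  have E01 := congr1 (fun M : 'M[R]_2 => M 0 1) E.
  have E10 := congr1 (fun M : 'M[R]_2 => M 1 0) E.
  move: E00 E01 E10; rewrite !mxE /= => E00 E01 E10.
  by split; lra.
have P10 s t : J s -> I t -> P s t 1 0 = 2 * kappa s t - 4.
  move=> Js It; have [LP _] := laxP Js It; have [LQ _] := laxQ Js It.
  have Q00 u v : J u -> I v -> Q u v 0 0 = P u v 0 0.
    by move=> Ju Iv; case: (Qe u v Ju Iv).
  have LPQ := agree_partial_s oJ Q00 Js It.
  have [_ Q01 Q10] := Qe s t Js It.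
  move: LQ; rewrite LPQ LP Q01 Q10 => LQ; lra.
have P00 s t : J s -> I t -> P s t 0 0 = - ks s t.
  move=> Js It; have [_ LP] := laxP Js It.
  have d : is_derive s 1 (fun s => 2 * kappa s t - 4) (2 * ks s t).
    have := is_deriveB (is_deriveM (is_derive_cst (2 : R) s 1)
      (is_derive_partial_s (Ck 1) Js It)) (is_derive_cst (4 : R) s 1).
    by move=> /is_derive_eq; apply; rewrite subr0 scaler0 addr0.
  have /is_derive1P[_ E] := d.
  have LPk := agree_partial_s oJ P10 Js It.
  have E2 : 2 * ks s t = - 2 * P s t 0 0.
    by rewrite -E -LP; exact: esym.
  lra.
move=> s t Js It.
have P01 : P s t 0 1 = - kss s t + 2 * kappa s t ^+ 2 - 2 * kappa s t - 4.
  have [LP _] := laxP Js It.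
  have /is_derive1P[_ E] :=
    is_deriveN (is_derive_partial_s ((smooth2_partial_s Ck) 1) Js It).
  have LPk := agree_partial_s oJ P00 Js It.
  have E2 : - kss s t = P s t 0 1 - (kappa s t + 1) * P s t 1 0.
    by rewrite -LP -E; exact: esym.
  move: E2; rewrite P10// => E2; lra.
have [Q00 Q01 Q10] := Qe s t Js It.
split; apply: mx22P; rewrite !mx22E.
- exact: P00.
- exact: P01.
- exact: P10.
- by rewrite trP// P00 ?opprK.
- by rewrite Q00 P00.
- rewrite Q01 P01; ring.
- rewrite Q10 P10//; ring.
- by rewrite trQ// Q00 P00 ?opprK.
Qed.

End TwoFrames.
End Evolution.
(** * The Wahlquist--Estabrook equation *)

Section Riccati.
Context {R : realType} (J I : set R) (oJ : open J) (oI : open I).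

(** The total differential, evaluated on the two coordinate directions. *)
Lemma is_diff_partials (f : R -> R -> R) (p q s t : R) :
  is_diff (s, t) (fun z : R * R => f z.1 z.2) (fun v : R * R => p * v.1 + q * v.2) ->
  is_derive s 1 (f^~ t) p /\ is_derive t 1 (f s) q.
Proof.
move=> [df dfE]; set g := fun z : R * R => f z.1 z.2 in df dfE.
have dg v : is_derive (s, t) v g (p * v.1 + q * v.2).
  apply: DeriveDef; first exact: diff_derivable.
  by rewrite deriveE// dfE.
split.
- have [+ +] := dg (1, 0); rewrite /derivable /derive.
  rewrite (_ : (fun h => h^-1 *: _) = fun h => h^-1 *: (f (h *: 1 + s) t - f s t)).
    by move=> d E; apply: DeriveDef => //; rewrite /derive E mulr1 mulr0 addr0.
  by apply/funext => h; rewrite /g /= scaler0 add0r.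
- have [+ +] := dg (0, 1); rewrite /derivable /derive.
  rewrite (_ : (fun h => h^-1 *: _) = fun h => h^-1 *: (f s (h *: 1 + t) - f s t)).
    by move=> d E; apply: DeriveDef => //; rewrite /derive E mulr1 mulr0 add0r.
  by apply/funext => h; rewrite /g /= scaler0 add0r.
Qed.

Context (lambda : R) (kappa f : R -> R -> R).
Hypothesis Ck : smooth2 J I kappa.
Hypothesis WE : Wahlquist_Estabrook J I lambda kappa f.

(** The coefficient of [dt] in the Wahlquist--Estabrook equation. *)
Definition WE_t : R -> R -> R := fun s t =>
  4 * lambda * (f s t ^+ 2 - lambda) - 2 * kappa s t * (f s t ^+ 2 + lambda)
  + 2 * kappa s t ^+ 2 + 2 * f s t * partial_s kappa s t
  - partial_s (partial_s kappa) s t.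

Lemma WE_is_derive_s (s t : R) : J s -> I t ->
  is_derive s 1 (f^~ t) (kappa s t - f s t ^+ 2 + lambda).
Proof. by move=> Js It; have [] := is_diff_partials (WE Js It). Qed.

Lemma WE_is_derive_t (s t : R) : J s -> I t -> is_derive t 1 (f s) (WE_t s t).
Proof. by move=> Js It; have [] := is_diff_partials (WE Js It). Qed.

(** Bootstrapping: a differentiable [f] is continuous, and its partial
    derivatives are polynomials in [f] and in derivatives of the smooth
    [kappa], hence as regular as [f] itself. *)
Lemma WE_smooth2 : smooth2 J I f.
Proof.
have C0 : Ck2 0 J I f.
  split=> // s t Js It; apply: differentiable_continuous.
  by have [] := WE Js It.
elim=> [//|k Cf].
have cst c : Ck2 k J I (fun _ _ => c : R) := Ck2_cst oJ oI k c.
have Cf2 := Ck2_exp oJ oI 2 Cf; have Ckk := Ck2_exp oJ oI 2 (Ck k).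
have Cks := smooth2_partial_s Ck; have Ckss := smooth2_partial_s Cks.
apply: (Ck2_intro oJ oI C0 WE_is_derive_s WE_is_derive_t).
  exact: (Ck2_add oJ oI (Ck2_add oJ oI (Ck k) (Ck2_opp oJ oI Cf2)) (cst lambda)).
have Cf2l := Ck2_add oJ oI Cf2 (cst lambda).
have Cf2Nl := Ck2_add oJ oI Cf2 (Ck2_opp oJ oI (cst lambda)).
have T1 := Ck2_mul oJ oI (Ck2_mul oJ oI (cst 4) (cst lambda)) Cf2Nl.
have T2 := Ck2_opp oJ oI (Ck2_mul oJ oI (Ck2_mul oJ oI (cst 2) (Ck k)) Cf2l).
have T3 := Ck2_mul oJ oI (cst 2) Ckk.
have T4 := Ck2_mul oJ oI (Ck2_mul oJ oI (cst 2) Cf) (Cks k).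
have T12 := Ck2_add oJ oI T1 T2; have T123 := Ck2_add oJ oI T12 T3.
have T1234 := Ck2_add oJ oI T123 T4.
exact: (Ck2_add oJ oI T1234 (Ck2_opp oJ oI (Ckss k))).
Qed.

End Riccati.
(** * The Darboux matrices *)

Section HyperbolicIdentities.
Context {R : realType}.
Implicit Type x : R.

Lemma cosh_gt0 x : 0 < cosh x.
Proof. by rewrite divr_gt0// addr_gt0 ?expR_gt0. Qed.

Lemma sinh_neq0 x : x != 0 -> sinh x != 0.
Proof.
apply: contraNneq => /eqP; rewrite /sinh mulf_eq0 invr_eq0 pnatr_eq0 orbF subr_eq0.
by move=> /eqP/expR_inj E; apply/eqP; lra.
Qed.

Lemma cosh_double x : (cosh (2 * x) - 1 = 2 * sinh x ^+ 2) *
  (cosh (2 * x) + 1 = 2 * cosh x ^+ 2).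
Proof.
have E : expR x * expR (- x) = 1 by rewrite -expRD addrN expR0.
have E2 : expR (2 * x) = expR x * expR x by rewrite -expRD; congr expR; ring.
have EN2 : expR (- (2 * x)) = expR (- x) * expR (- x).
  by rewrite -expRD; congr expR; ring.
split; rewrite /cosh /sinh E2 EN2.
  by rewrite -[X in _ - X = _]E; field.
by rewrite -[X in _ + X = _]E; field.
Qed.

End HyperbolicIdentities.

Section Darboux.
Context {R : realType}.
Implicit Types (c e k lambda x xi : R) (X Y : 'M[R]_2).

(** Gauge matrix of the Darboux transformation. If [eta'' = (k + e) eta] and
    [f' = k - f^2 + lambda], then [eta' - f eta] solves the equation with
    potential [- k + 2 f^2 - 2 lambda + e]; the columns are the coordinates
    of [eta' - f eta] and of its derivative in the frame [(eta, eta')]. *)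
Definition darboux_mx e lambda x : 'M[R]_2 :=
  mx22 (- x) (e - lambda + x ^+ 2) 1 (- x).

(** This is where the normalization [det (eta, eta') = 1] of the new cousins
    fixes the scalar [c]. *)
Lemma det_darboux c e lambda x X : \det X = 1 ->
  \det (c *: (X *m darboux_mx e lambda x)) = c ^+ 2 * (lambda - e).
Proof. by move=> dX; rewrite detZ det_mulmx dX det_mx22; ring. Qed.

Lemma is_derive_darboux c e k lambda (F : R -> 'M[R]_2) (f : R -> R) (s : R) :
  is_derive s 1 F (F s *m mx22 0 (k + e) 1 0) ->
  is_derive s 1 f (k - f s ^+ 2 + lambda) ->
  is_derive s 1 (fun x => c *: (F x *m darboux_mx e lambda (f x)))
    (c *: (F s *m darboux_mx e lambda (f s)) *m
     mx22 0 (- k + 2 * f s ^+ 2 - 2 * lambda + e) 1 0).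
Proof.
move=> dF df.
have dN : is_derive s 1 (fun x => darboux_mx e lambda (f x))
    (mx22 (- (k - f s ^+ 2 + lambda)) (2 * f s * (k - f s ^+ 2 + lambda)) 0
      (- (k - f s ^+ 2 + lambda))).
  have := is_deriveD (is_derive_cst (e - lambda) s 1) (is_deriveX 2 df).
  rewrite add0r => dq.
  have := is_derive_mx22 (is_deriveN df) dq (is_derive_cst (1 : R) s 1) (is_deriveN df).
  by move=> /is_derive_eq; apply; congr mx22; rewrite /GRing.scale/= expr1; ring.
have := is_deriveZ c (is_derive_mulmx dF dN).
move=> /is_derive_eq; apply.
rewrite -scalemxAl -!mulmxA -mulmxDr /darboux_mx !mx22_arith.
by congr (_ *: (_ *m mx22 _ _ _ _)); ring.
Qed.

(** The matrix of [T_formula] freed of hyperbolic functions: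
    with [lambda = cosh (2 xi)] it is [2 sinh xi cosh xi] times that matrix
    (see [T_formulaE]). *)
Definition T_mx lambda x : 'M[R]_2 := mx22 (lambda - 1) (- 2 * x) 0 (lambda + 1).

(** The triangular matrix of the transform is a quotient of the two Darboux
    matrices, which is why [T_formula] is the curve whose spinor frame consists
    of the two Darboux-transformed frames. *)
Lemma darboux_conj lambda x :
  darboux_mx 1 lambda x *m adj2 (darboux_mx (-1) lambda x) = T_mx lambda x.
Proof.
by rewrite /T_mx /darboux_mx /adj2 !mx22E mul_mx22; congr mx22; ring.
Qed.

Lemma adj2_darboux c c' lambda x X Y :
  c *: (X *m darboux_mx 1 lambda x) *m
    adj2 (c' *: (Y *m darboux_mx (-1) lambda x)) =
  X *m ((c * c') *: T_mx lambda x) *m adj2 Y.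
Proof.
rewrite adj2Z adj2M -scalemxAl -!scalemxAr scalerA -darboux_conj.
by rewrite -scalemxAl !mulmxA.
Qed.

Lemma T_formulaE (b : bool) xi x X Y : xi != 0 -> \det Y = 1 ->
  T_formula b xi x X Y =
  X *m (((-1) ^+ b / (2 * sinh xi * cosh xi)) *: T_mx (cosh (2 * xi)) x) *m adj2 Y.
Proof.
move=> xi0 dY; rewrite /T_formula invmx_SL2// scalemxAl scalemxAr scale_mx22.
have s0 := sinh_neq0 xi0; have c0 : cosh xi != 0 by rewrite gt_eqF ?cosh_gt0.
rewrite /T_mx !cosh_double scale_mx22 /tanh /coth /csch /sech.
by congr (_ *m mx22 _ _ _ _ *m _); field; rewrite s0 c0.
Qed.

(** The LIEN equation for the transformed curve, read in the original frame:
    the left-hand side is the action on [T_mx] of the time evolution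
    of the two frames, with [x] moving by the [dt] part of the
    Wahlquist--Estabrook equation; the right-hand side is the LIEN velocity with
    the new bending, carried over by the Darboux matrices. *)
Lemma darboux_evolution lambda k ks kss x :
  mx22 (- ks) (- kss + 2 * k ^+ 2 - 2 * k - 4) (2 * k - 4) ks *m T_mx lambda x
  + mx22 0 (- 2 * (4 * lambda * (x ^+ 2 - lambda) - 2 * k * (x ^+ 2 + lambda)
          + 2 * k ^+ 2 + 2 * x * ks - kss)) 0 0
  - T_mx lambda x *m
    mx22 (- ks) (- kss + 2 * k ^+ 2 + 2 * k - 4) (2 * k + 4) ks =
  darboux_mx 1 lambda x *m
    mx22 0 (- 4 * (- k + 2 * x ^+ 2 - 2 * lambda)) (- 8) 0 *m
    adj2 (darboux_mx (-1) lambda x).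
Proof.
by rewrite /T_mx /darboux_mx /adj2 !mx22E !mx22_arith; congr mx22; ring.
Qed.

End Darboux.
(** * Spinor frames along a solution of the LIEN flow *)

Section LIENFrames.
Context {R : realType} (J I : set R) (oJ : open J) (oI : open I).
Context (gamma F G : R -> R -> 'M[R]_2).
Hypothesis Hgamma : LIEN_solution J I gamma.
Hypothesis HFG : spinor_frame2 J I gamma F G.
Let kappa := bending2 gamma.

Lemma frame_det_p s t : J s -> I t -> \det (F s t) = 1.
Proof. by move=> Js It; exact: spinor_SL_p (spinor2_frame HFG It) s Js. Qed.

Lemma frame_det_m s t : J s -> I t -> \det (G s t) = 1.
Proof. by move=> Js It; exact: spinor_SL_m (spinor2_frame HFG It) s Js. Qed.

Lemma frame_curve s t : J s -> I t -> gamma s t = F s t *m adj2 (G s t).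
Proof.
move=> Js It; have H := spinor2_frame HFG It.
by rewrite (spinor_curve H Js) invmx_SL2//; exact: frame_det_m.
Qed.

Lemma frame_partial_s s t : J s -> I t ->
  partial_s F s t = F s t *m mx22 0 (kappa s t + 1) 1 0 /\
  partial_s G s t = G s t *m mx22 0 (kappa s t - 1) 1 0.
Proof.
move=> Js It; have H := spinor2_frame HFG It.
by split; [exact: spinor_eq_p H s Js | exact: spinor_eq_m H s Js].
Qed.

Lemma frame_is_derive_s (s t : R) : J s -> I t ->
  is_derive s 1 (F^~ t) (F s t *m mx22 0 (kappa s t + 1) 1 0) /\
  is_derive s 1 (G^~ t) (G s t *m mx22 0 (kappa s t - 1) 1 0).
Proof.
move=> Js It; have [<- <-] := frame_partial_s Js It.
by split; [exact: is_derive_partial_s (spinor2_smooth_p HFG 1) Js It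
          |exact: is_derive_partial_s (spinor2_smooth_m HFG 1) Js It].
Qed.

(** Both sides of the LIEN flow have the form [F N G^-1]; on the
    left [N] is the difference of the logarithmic derivatives. *)
Lemma LIEN_frame_difference s t : J s -> I t ->
  log_t_derivative F s t - log_t_derivative G s t =
  mx22 0 (- 4 * kappa s t) (- 8) 0.
Proof.
move=> Js It; apply: (sandwich_inj (frame_det_p Js It) (frame_det_m Js It)).
have E := @frame_LIEN_velocity R J oJ (F^~ t) (G^~ t) (gamma^~ t) (kappa^~ t)
  (fun u Ju => (frame_is_derive_s Ju It).1) (fun u Ju => (frame_is_derive_s Ju It).2)
  (fun u Ju => frame_det_p Ju It) (fun u Ju => frame_det_m Ju It)
  (fun u Ju => frame_curve Ju It) s Js.
rewrite -E; apply: etrans _ (LIEN_eq Hgamma Js It).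
have Ft := is_derive_partial_t (spinor2_smooth_p HFG 1) Js It.
have Gt := is_derive_partial_t (spinor2_smooth_m HFG 1) Js It.
rewrite (@partial_t_frame _ _ _ _ frame_det_p _ _ Js It) in Ft.
rewrite (@partial_t_frame _ _ _ _ frame_det_m _ _ Js It) in Gt.
have trG : \tr (log_t_derivative G s t) = 0.
  have := log_t_derivative_traceless oI (spinor2_smooth_m HFG)
    frame_det_m Js It.
  rewrite /mxtrace !big_ord_recl big_ord0 addr0.
  rewrite (_ : lift ord0 ord0 = 1); last exact: val_inj.
  by move=> ->; rewrite addrN.
have := is_derive_sandwich Ft Gt (is_derive_cst (1%:M : 'M[R]_2) t 1) trG.
rewrite mulmx1 addr0 mul1mx => D.
suff /is_derive1P[_ E1] : is_derive t 1 (gamma s)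
  (F s t *m (log_t_derivative F s t - log_t_derivative G s t) *m adj2 (G s t)).
  exact: esym.
apply: near_eq_is_derive D.
by apply: near_open It _ => // v Iv; rewrite mulmx1 frame_curve.
Qed.

Let ks := partial_s kappa.
Let kss := partial_s (partial_s kappa).

(** The LIEN flow determines the time evolution of both frames, not merely of
    their quotient: [solve_lax_pair] recovers each logarithmic derivative from
    the difference of the two. *)
Lemma LIEN_frame_evolution (s t : R) : J s -> I t ->
  is_derive t 1 (F s) (F s t *m mx22 (- ks s t)
    (- kss s t + 2 * kappa s t ^+ 2 - 2 * kappa s t - 4)
    (2 * kappa s t - 4) (ks s t)) /\
  is_derive t 1 (G s) (G s t *m mx22 (- ks s t)
    (- kss s t + 2 * kappa s t ^+ 2 + 2 * kappa s t - 4)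
    (2 * kappa s t + 4) (ks s t)).
Proof.
move=> Js It; have CF := spinor2_smooth_p HFG; have CG := spinor2_smooth_m HFG.
have Ck := smooth2_bending oJ oI (LIEN_smooth Hgamma).
have [<- <-] := solve_lax_pair oJ Ck
  (@log_t_derivative_traceless _ _ _ oI _ CF frame_det_p)
  (@log_t_derivative_traceless _ _ _ oI _ CG frame_det_m)
  (@lax_entries _ _ _ oJ oI kappa 1 F Ck CF frame_det_p
    (fun u v Ju Iv => (frame_partial_s Ju Iv).1))
  (@lax_entries _ _ _ oJ oI kappa (-1) G Ck CG frame_det_m
    (fun u v Ju Iv => (frame_partial_s Ju Iv).2))
  LIEN_frame_difference Js It.
rewrite -(@partial_t_frame _ _ _ _ frame_det_p _ _ Js It).
rewrite -(@partial_t_frame _ _ _ _ frame_det_m _ _ Js It).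
by split; [exact: is_derive_partial_t (CF 1) Js It
          |exact: is_derive_partial_t (CG 1) Js It].
Qed.

End LIENFrames.
(** * The transformed flow *)

Section TransformedFlow.
Context {R : realType} (J I : set R) (oJ : open J) (oI : open I).
Context (gamma F G : R -> R -> 'M[R]_2).
Hypothesis Hgamma : LIEN_solution J I gamma.
Hypothesis HFG : spinor_frame2 J I gamma F G.
Let kappa := bending2 gamma.
Context (lambda : R) (f : R -> R -> R).
Hypothesis WE : Wahlquist_Estabrook J I lambda kappa f.
Context (c c' : R).
Hypothesis c_norm : c ^+ 2 * (lambda - 1) = 1.
Hypothesis c'_norm : c' ^+ 2 * (lambda + 1) = 1.
Context (gammat : R -> R -> 'M[R]_2).
Hypothesis gammatE : forall s t, J s -> I t ->
  gammat s t = F s t *m ((c * c') *: T_mx lambda (f s t)) *m adj2 (G s t).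

Let Ck : smooth2 J I kappa := smooth2_bending oJ oI (LIEN_smooth Hgamma).
Let Cf : smooth2 J I f := WE_smooth2 oJ oI Ck WE.

(** The Darboux transform, scaled by [a], of a frame for the potential
    [kappa + e]. *)
Definition transformed_frame (a e : R) (X : R -> R -> 'M[R]_2) : R -> R -> 'M[R]_2 :=
  fun s t => a *: (X s t *m darboux_mx e lambda (f s t)).

Let Ft := transformed_frame c 1 F.
Let Gt := transformed_frame c' (-1) G.
Let kappat := Backlund lambda kappa f.

Lemma smooth2_transformed a e (X : R -> R -> 'M[R]_2) :
  smooth2 J I X -> smooth2 J I (transformed_frame a e X).
Proof.
move=> CX k.
have CD : smooth2 J I (fun s t => darboux_mx e lambda (f s t)).
  have CN : smooth2 J I (fun s t => - f s t) by move=> j; exact: (Ck2_opp oJ oI (Cf j)).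
  apply: (smooth2_mx22 oJ oI CN _ _ CN) => j; last exact: Ck2_cst.
  exact: (Ck2_add oJ oI (Ck2_cst oJ oI j (e - lambda)) (Ck2_exp oJ oI 2 (Cf j))).
have CM := Ck2_mulmx oJ oI (CX k) (CD k).
apply/(Ck2_mxP oJ oI) => i j.
have C := Ck2_mul oJ oI (Ck2_cst oJ oI k a) ((Ck2_mxP oJ oI k _).1 CM i j).
by apply: (Ck2_ext oJ oI _ C) => s t _ _; rewrite [RHS]mxE.
Qed.

Let CFt : smooth2 J I Ft := smooth2_transformed c 1 (spinor2_smooth_p HFG).
Let CGt : smooth2 J I Gt := smooth2_transformed c' (-1) (spinor2_smooth_m HFG).

Lemma transformed_det_p s t : J s -> I t -> \det (Ft s t) = 1.
Proof.
by move=> Js It; rewrite /Ft /transformed_frame det_darboux// (frame_det_p HFG Js It).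
Qed.

Lemma transformed_det_m s t : J s -> I t -> \det (Gt s t) = 1.
Proof.
move=> Js It; rewrite /Gt /transformed_frame det_darboux ?opprK//.
exact: frame_det_m HFG _ _ Js It.
Qed.

Lemma transformed_curve s t : J s -> I t -> gammat s t = Ft s t *m adj2 (Gt s t).
Proof. by move=> Js It; rewrite gammatE// /Ft /Gt /transformed_frame adj2_darboux. Qed.

Lemma transformed_is_derive_p (s t : R) : J s -> I t ->
  is_derive s 1 (Ft^~ t) (Ft s t *m mx22 0 (kappat s t + 1) 1 0).
Proof.
move=> Js It; have [dF _] := frame_is_derive_s HFG Js It.
exact: (is_derive_darboux c dF (WE_is_derive_s WE Js It)).
Qed.

Lemma transformed_is_derive_m (s t : R) : J s -> I t ->
  is_derive s 1 (Gt^~ t) (Gt s t *m mx22 0 (kappat s t - 1) 1 0).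
Proof.
move=> Js It; have [_ dG] := frame_is_derive_s HFG Js It.
exact: (is_derive_darboux c' dG (WE_is_derive_s WE Js It)).
Qed.

Lemma smooth2_gammat : smooth2 J I gammat.
Proof.
move=> k.
have C := Ck2_mulmx oJ oI (CFt k) (smooth2_adj2 oJ oI CGt k).
by apply: (Ck2_ext oJ oI _ C) => s t Js It; rewrite transformed_curve.
Qed.

Section FixedTime.
Context (t : R) (It : I t).
Let dFt (s : R) (Js : J s) := transformed_is_derive_p Js It.
Let dGt (s : R) (Js : J s) := transformed_is_derive_m Js It.
Let detFt s (Js : J s) := transformed_det_p Js It.
Let detGt s (Js : J s) := transformed_det_m Js It.
Let gE s (Js : J s) := transformed_curve Js It.

Lemma transformed_null_curve : null_curve J (gammat^~ t).
Proof.
exact: (@frame_null_curve _ _ oJ _ _ _ _ dFt dGt detFt detGt gE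
  (smooth2_slice smooth2_gammat It)).
Qed.

Lemma transformed_bending s : J s -> bending (gammat^~ t) s = kappat s t.
Proof.
by move=> Js; exact: (@frame_bending _ _ oJ _ _ _ _ dFt dGt detFt detGt gE s Js).
Qed.

Lemma transformed_spinor_frame : spinor_frame J (gammat^~ t) (Ft^~ t) (Gt^~ t).
Proof.
split.
- exact: smooth2_slice CFt It.
- exact: smooth2_slice CGt It.
- exact: detFt.
- exact: detGt.
- by move=> s Js; rewrite invmx_SL2; [exact: gE | exact: detGt].
- by move=> s Js; rewrite transformed_bending//; have /is_derive1P[_ ->] := dFt Js.
- by move=> s Js; rewrite transformed_bending//; have /is_derive1P[_ ->] := dGt Js.
Qed.

Lemma transformed_LIEN s : J s -> partial_t gammat s t =
  2 *: derive1n 3 (gammat^~ t) s - (6 * bending2 gammat s t) *: partial_s gammat s t.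
Proof.
move=> Js.
have E := @frame_LIEN_velocity _ _ oJ _ _ _ _ dFt dGt detFt detGt gE s Js.
apply: etrans _ (esym E).
have [DF DG] := LIEN_frame_evolution oJ oI Hgamma HFG Js It.
have Df := WE_is_derive_t WE Js It.
have DT : is_derive t 1 (fun v => (c * c') *: T_mx lambda (f s v))
    ((c * c') *: mx22 0 (- 2 * WE_t lambda kappa f s t) 0 0).
  have Dm := is_derive_mx22 (is_derive_cst (lambda - 1) t 1)
    (is_deriveZ (- 2) Df) (is_derive_cst (0 : R) t 1) (is_derive_cst (lambda + 1) t 1).
  exact: (is_deriveZ (c * c') Dm).
have trG : forall a b d : R, \tr (mx22 (- a) b d a) = 0.
  by move=> a b d; rewrite /mxtrace !big_ord_recl big_ord0 !mxE /= addr0 addNr.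
have D := is_derive_sandwich DF DG DT (trG _ _ _).
have nE : {near t, (fun v =>
    F s v *m ((c * c') *: T_mx lambda (f s v)) *m adj2 (G s v)) =1 gammat s}.
  by apply: near_open It _ => // v Iv; rewrite gammatE.
have /is_derive1P[_ E1] := near_eq_is_derive nE D.
apply: etrans E1 _.
rewrite -scalemxAl -scalemxAr -scalerDr -scalerBr darboux_evolution.
rewrite /Ft /Gt /transformed_frame adj2Z adj2M.
by rewrite -!(scalemxAl, scalemxAr) !scalerA !mulmxA [c * c']mulrC.
Qed.

End FixedTime.

Lemma transformed_LIEN_solution : LIEN_solution J I gammat.
Proof.
split; first exact: smooth2_gammat.
- exact: transformed_null_curve.
- by move=> s t Js It; exact: transformed_LIEN.
Qed.

End TransformedFlow.
(** * Cousins, and the theorem *)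

Section Cousins.
Context {R : realType}.

Lemma row_mx22 (u v : 'cV[R]_2) :
  row_mx u v = mx22 (u 0 0) (v 0 0) (u 1 0) (v 1 0) :> 'M[R]_2.
Proof.
apply: mx22P; rewrite mx22E; rewrite -?(row_mxEl u v) -?(row_mxEr u v);
  by congr (row_mx _ _ _ _); apply: val_inj.
Qed.

(** Only the component of the first column of [X N] along the second column of
    [X] survives in the determinant. *)
Lemma det2_first_col (X N : 'M[R]_2) :
  det2 (col 0 X) (col 0 (X *m N)) = \det X * N 1 0.
Proof.
rewrite /det2 row_mx22 det_mx22 ![col _ _ _ _]mxE.
by rewrite [X]mx22_eta [N]mx22_eta mul_mx22 det_mx22 !mx22E; ring.
Qed.

Lemma derive1_first_col (F : R -> 'M[R]_2) (s : R) dF :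
  is_derive s 1 F dF -> derive1 (first_col F) s = col 0 dF.
Proof.
move=> /is_derive_mxP dFij.
suff /is_derive1P[_ ->] : is_derive s 1 (first_col F) (col 0 dF) by [].
apply/is_derive_mxP => i j; rewrite mxE.
by rewrite (_ : (fun x => _) = fun x => F x i 0)//; apply/funext => x; rewrite mxE.
Qed.

End Cousins.

Unset Implicit Arguments.

Theorem theorem4p4 (R : realType) (J I : set R)
  (hJ : open_interval J) (hI : open_interval I) (hJ0 : J 0) (hI0 : I 0)
  (gamma Fp Fm : R -> R -> 'M[R]_2)
  (hgamma : LIEN_solution J I gamma)
  (hF : spinor_frame2 J I gamma Fp Fm)
  (xi lambda : R) (hxi : xi != 0) (hlambda : lambda = cosh (2 * xi))
  (f : R -> R -> R)
  (hf : Wahlquist_Estabrook J I lambda (bending2 gamma) f)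
  (b : bool) (gammat : R -> R -> 'M[R]_2)
  (hgammat : forall s t, J s -> I t ->
     gammat s t = T_formula b xi (f s t) (Fp s t) (Fm s t)) :
  (forall t, I t ->
     T_transform_with J xi (f^~ t) (gamma^~ t) (gammat^~ t)) /\
  (LIEN_solution J I gammat /\
   forall s t, J s -> I t ->
     bending2 gammat s t = Backlund lambda (bending2 gamma) f s t).
Proof.
have [oJ _] := hJ; have [oI _] := hI.
have s0 := sinh_neq0 hxi; have c0 : cosh xi != 0 by rewrite gt_eqF ?cosh_gt0.
have r0 : Num.sqrt 2 != 0 :> R by rewrite gt_eqF ?sqrtr_gt0.
have r2 : Num.sqrt 2 ^+ 2 = 2 :> R by rewrite sqr_sqrtr.
(* Scalings that give the new cousins unit Wronskian, as lambda - 1 and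
   lambda + 1 are 2 sinh^2 xi and 2 cosh^2 xi. The global sign of the curve is
   absorbed by the second frame. *)
set c := (Num.sqrt 2 * sinh xi)^-1; set c' := (-1) ^+ b / (Num.sqrt 2 * cosh xi).
have cn : c != 0 by rewrite invr_neq0// mulf_neq0.
have c'n : c' != 0 by rewrite mulf_neq0 ?signr_eq0// invr_neq0// mulf_neq0.
have cE : c ^+ 2 * (lambda - 1) = 1.
  rewrite hlambda cosh_double /c exprVn exprMn r2.
  by rewrite mulVf// mulf_neq0 ?expf_neq0 ?pnatr_eq0.
have c'E : c' ^+ 2 * (lambda + 1) = 1.
  rewrite hlambda cosh_double /c' exprMn sqrr_sign mul1r exprVn exprMn r2.
  by rewrite mulVf// mulf_neq0 ?expf_neq0 ?pnatr_eq0.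
have cc' : c * c' = (-1) ^+ b / (2 * sinh xi * cosh xi).
  by rewrite /c /c' -{3}r2; field; rewrite s0 c0 r0.
have gtE s t : J s -> I t -> gammat s t =
    Fp s t *m ((c * c') *: T_mx lambda (f s t)) *m adj2 (Fm s t).
  move=> Js It; rewrite hgammat// T_formulaE ?cc' ?hlambda//.
  exact: frame_det_m hF s t Js It.
split; last first.
  split; first exact: (transformed_LIEN_solution oJ oI hgamma hF hf cE c'E gtE).
  by move=> s t Js It; exact: (transformed_bending oJ hF hf cE c'E gtE It Js).
move=> t It.
have frame_t := transformed_spinor_frame oJ oI hgamma hF hf cE c'E gtE It.
split=> //.
- move=> s Js; have /is_derive1P[df ->] := WE_is_derive_s hf Js It.
  by split=> //; rewrite -hlambda /bending2; ring.
- split; first exact: LIEN_null hgamma t It.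
    exact: (transformed_null_curve oJ oI hgamma hF hf cE c'E gtE It).
  exists (first_col (Fp^~ t)), (first_col (Fm^~ t)).
  exists (first_col ((transformed_frame lambda f c 1 Fp)^~ t)).
  exists (first_col ((transformed_frame lambda f c' (-1) Fm)^~ t)).
  have detp s (Js : J s) : \det (Fp s t) = 1 := frame_det_p hF Js It.
  have detm s (Js : J s) : \det (Fm s t) = 1 := frame_det_m hF Js It.
  have Ep s : J s -> det2 (first_col (Fp^~ t) s)
      (first_col ((transformed_frame lambda f c 1 Fp)^~ t) s) = c.
    move=> Js; rewrite /first_col /transformed_frame scalemxAr det2_first_col.
    by rewrite detp// mul1r /darboux_mx scale_mx22 !mx22E mulr1.
  have Em s : J s -> det2 (first_col (Fm^~ t) s)
      (first_col ((transformed_frame lambda f c' (-1) Fm)^~ t) s) = c'.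
    move=> Js; rewrite /first_col /transformed_frame scalemxAr det2_first_col.
    by rewrite detm// mul1r /darboux_mx scale_mx22 !mx22E mulr1.
  split.
  + by exists (Fp^~ t), (Fm^~ t); split=> //; exact: spinor2_frame hF t It.
  + by exists ((transformed_frame lambda f c 1 Fp)^~ t),
      ((transformed_frame lambda f c' (-1) Fm)^~ t).
  + by exists c.
  + by exists c'.
  + move=> s Js; rewrite Ep// Em//.
    rewrite (derive1_first_col (transformed_is_derive_p hF hf c Js It)).
    rewrite (derive1_first_col (transformed_is_derive_m hF hf c' Js It)).
    rewrite /first_col /transformed_frame !scalemxAr -!mulmxA !det2_first_col.
    rewrite detp// detm// /darboux_mx !mx22_arith !mx22E; ring.
- exists b, (Fp^~ t), (Fm^~ t); split; first exact: spinor2_frame hF t It.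
  by move=> s Js; exact: hgammat.
Qed.
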